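(* Let $\Phi$ denote the flow of the cubic nonlinear Klein-Gordon equation $u_{tt}-\Delta u+u+u^3=0$ on $\mathbb{T}^3$. Fix $R>0$, $k_0\in\mathbb{Z}^3$, $z\in\mathbb{C}$, and $u_*\in\mathcal{H}^{1/2}(\mathbb{T}^3)$. For all $0<\eta<R$, there exist $N\equiv N(\eta,u_*,R,k_0)$ and $\sigma\equiv\sigma(\eta,N,u_* )>0$ such that for all $0\le t\le\sigma$, $$\Phi(t)\bigl(\Pi_N\mathbf{B}_R(u_* )\bigr)\not\subseteq\mathbf{C}_r(z;k_0)\qquad\text{for } r<R-\eta .$$
   Context: Notation: $\mathbb{T}^3=(\mathbb{R}/2\pi\mathbb{Z})^3$, $\langle k\rangle=(1+|k|^2)^{1/2}$. All functions are real-valued. $\mathcal{H}^{s}=H^{s}(\mathbb{T}^3)\times H^{s-1}(\mathbb{T}^3)$ (inhomogeneous Sobolev spaces, product norm). $\mathbf{B}_R(u_* )=\{u\in\mathcal{H}^{1/2}(\mathbb{T}^3):\|u-u_*\|_{\mathcal{H}^{1/2}}\le R\}$. $\Pi_N$ is the sharp Fourier projection onto frequencies $|k|\le N$ (applied to each component). Flow: for data $(u,\partial_tu)|_{t=0}=(u_0,u_1)\in\mathcal{H}^{1/2}$, $\Phi(t)(u_0,u_1)=(u(t),\partial_tu(t))$, where $u$ is the strong (Duhamel) solution of the equation, as long as it exists. The assertion about $\Phi(t)(A)$ is understood to include that the solutions with data in $A$ exist on $[0,t]$. Cylinder: for $z=(z_0,z_1)\in\mathbb{C}\cong\mathbb{R}^2$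 and $r>0$, $$\mathbf{C}_r(z;k_0)=\{(u_0,u_1)\in\mathcal{H}^{1/2}(\mathbb{T}^3):\langle k_0\rangle|\widehat{u}_0(k_0)-z_0|^2+\langle k_0\rangle^{-1}|\widehat{u}_1(k_0)-z_1|^2\le r^2\}.$$ Here $\widehat{u}_i(k)$ are real-valued Fourier coefficients, i.e. coefficients with respect to a real orthonormal trigonometric basis of $L^2(\mathbb{T}^3)$ indexed by $k\in\mathbb{Z}^3$, normalized so that $\|(u_0,u_1)\|_{\mathcal{H}^{1/2}}^2=\sum_k\langle k\rangle|\widehat{u}_0(k)|^2+\langle k\rangle^{-1}|\widehat{u}_1(k)|^2$. *)

(* Defs.v *)
From HB Require Import structures.
From mathcomp Require Import all_boot all_order all_algebra.
From mathcomp Require Import all_classical all_reals all_analysis.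

Set Implicit Arguments.
Unset Strict Implicit.
Unset Printing Implicit Defensive.

Import Order.TTheory GRing.Theory Num.Theory.
Import numFieldNormedType.Exports.

Local Open Scope classical_set_scope.
Local Open Scope ring_scope.

Definition Z3 : Type := (int * int * int)%type.

(* The library's sigma-finiteness instance of product measures is shadowed by
   its instance for products of probabilities, hence these declarations. *)
Lemma product_measure1_sigma_finite d1 d2 (T1 : measurableType d1)
    (T2 : measurableType d2) (R : realType)
    (m1 : {sigma_finite_measure set T1 -> \bar R})
    (m2 : {sigma_finite_measure set T2 -> \bar R}) :
  sigma_finite [set: T1 * T2] (m1 \x m2)%E.
Proof.
have /sigma_finiteP[F [TF ndF Foo]] := sigma_finiteT m1.
have /sigma_finiteP[G [TG ndG Goo]] := sigma_finiteT m2.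
exists (fun n => F n `*` G n).
  rewrite -setXTT TF TG predeqE => -[x y]; split.
    move=> [/= [n _ Fnx] [k _ Gky]]; exists (maxn n k) => //; split.
    - by move: x Fnx; exact/subsetPset/ndF/leq_maxl.
    - by move: y Gky; exact/subsetPset/ndG/leq_maxr.
  by move=> [n _ []/= ? ?]; split; exists n.
move=> k; have [? ?] := Foo k; have [? ?] := Goo k.
split; first exact: measurableX.
by rewrite product_measure1E// lte_mul_pinfty// ge0_fin_numE.
Qed.

Section Torus.
Variable R : realType.

(* Functions on (R / 2 pi Z)^3 are functions on the cube [0, 2 pi)^3. *)
Local Notation R3 :=
  (measurableTypeR R * measurableTypeR R * measurableTypeR R)%type.

Definition torus : set R3 :=
  (`[0, 2 * pi[ `*` `[0, 2 * pi[) `*` `[0, 2 * pi[.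

Definition leb1 : {sigma_finite_measure set (measurableTypeR R) -> \bar R} :=
  @lebesgue_measure R.

Definition leb2 : set (measurableTypeR R * measurableTypeR R) -> \bar R :=
  (leb1 \x leb1)%E.
HB.instance Definition _ := Measure.on leb2.
HB.instance Definition _ := Measure_isSigmaFinite.Build _ _ _ leb2
  (product_measure1_sigma_finite leb1 leb1).

Definition leb3 : set R3 -> \bar R := (leb2 \x leb1)%E.
HB.instance Definition _ := Measure.on leb3.
HB.instance Definition _ := Measure_isSigmaFinite.Build _ _ _ leb3
  (product_measure1_sigma_finite leb2 leb1).

Definition dot (k : Z3) (x : R3) : R :=
  k.1.1%:~R * x.1.1 + k.1.2%:~R * x.1.2 + k.2%:~R * x.2.

Definition freq_norm (k : Z3) : R :=
  Num.sqrt (k.1.1%:~R ^+ 2 + k.1.2%:~R ^+ 2 + k.2%:~R ^+ 2).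

(* The Japanese bracket <k>. *)
Definition jap (k : Z3) : R := Num.sqrt (1 + freq_norm k ^+ 2).

(* Exactly one of k, -k lies in this half space when k != 0. *)
Definition pos_half (k : Z3) : bool :=
  [|| 0 < k.1.1,
      (k.1.1 == 0) && (0 < k.1.2) |
      [&& k.1.1 == 0, k.1.2 == 0 & 0 < k.2]].

(* Real trigonometric orthonormal basis of L^2(T^3): cosines on the half
   space, sines on the opposite one. *)
Definition trig_basis (k : Z3) (x : R3) : R :=
  let vol := (2 * pi) ^+ 3 in
  if k == (0, 0, 0) then (Num.sqrt vol)^-1
  else if pos_half k then Num.sqrt (2 / vol) * cos (dot k x)
  else Num.sqrt (2 / vol) * sin (dot k x).

Definition fourier (f : R3 -> R) (k : Z3) : R :=
  \int[leb3]_(x in torus) (f x * trig_basis k x).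

Definition square_integrable (f : R3 -> R) : Prop :=
  measurable_fun torus f /\
  (\int[leb3]_(x in torus) (f x ^+ 2)%:E < +oo)%E.

(* A real distribution on T^3 is encoded by its coefficients in [trig_basis];
   [fourier] maps a function to this encoding. *)
Definition distr : Type := Z3 -> R.

Definition sobolev_sq (s : R) (a : distr) : \bar R :=
  \esum_(k in [set: Z3]) (jap k `^ (2 * s) * a k ^+ 2)%:E.

Definition phase : Type := (distr * distr)%type.

(* The norm of H^s x H^(s-1), with value +oo outside of this space. *)
Definition phase_norm (s : R) (u : phase) : \bar R :=
  ((sobolev_sq s u.1 + sobolev_sq (s - 1) u.2) `^ (2^-1))%E.

Definition phase_space (s : R) : set phase :=
  [set u | (phase_norm s u < +oo)%E].

Definition ball_half (rad : R) (ustar : phase) : set phase :=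
  [set u | phase_space 2^-1 u /\ (phase_norm 2^-1 (u - ustar)%R <= rad%:E)%E].

Definition proj_distr (N : nat) (a : distr) : distr :=
  fun k => if freq_norm k <= N%:R then a k else 0.

Definition freq_proj (N : nat) (u : phase) : phase :=
  (proj_distr N u.1, proj_distr N u.2).

Definition cylinder (r : R) (z : R * R) (k0 : Z3) : set phase :=
  [set u | phase_space 2^-1 u /\
     jap k0 * (u.1 k0 - z.1) ^+ 2 + (jap k0)^-1 * (u.2 k0 - z.2) ^+ 2
       <= r ^+ 2].

(* [u] is a strong solution on [0, T] of u_tt - Delta u + u + u^3 = 0 with
   data [d], and [ut] is its time derivative.
   - The Duhamel formula
       u(t) = cos(t<D>) u_0 + <D>^-1 sin(t<D>) u_1
              - int_0^t <D>^-1 sin((t - s)<D>) u(s)^3 ds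
     is written on the coefficients, where the Fourier multipliers are
     diagonal (the two members of a pair cos(k.x), sin(k.x) have the same <k>).
     The coefficients of u(s)^3 are genuine integrals, as H^(1/2) embeds into
     L^3.
   - The time derivative of a distribution-valued curve is taken
     coefficientwise in the open interval; its values at 0 and T are fixed by
     [sol_init] and [sol_cont].
   - The condition u in L^4_{t,x} is the usual one at this (critical)
     regularity, in which solutions are unique. *)
Record strong_solution (T : R) (d : phase) (u : R -> R3 -> R) (ut : R -> distr)
    : Prop := StrongSolution {
  sol_L2 : forall t, 0 <= t <= T -> square_integrable (u t);
  sol_space : forall t, 0 <= t <= T ->
    phase_space 2^-1 (fourier (u t), ut t);
  sol_cont : forall t, 0 <= t <= T ->
    phase_norm 2^-1 ((fourier (u s), ut s) - (fourier (u t), ut t))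
      @[s --> within `[0, T] (nbhs t)] --> 0%E;
  sol_meas : measurable_fun ((`[0, T] : set (measurableTypeR R)) `*` torus)
    (fun p => u p.1 p.2);
  sol_L4 : (\int[(leb1 \x leb3)%E]_(p in `[0%R, T] `*` torus)
    (u p.1 p.2 ^+ 4)%:E < +oo)%E;
  sol_init : (fourier (u 0), ut 0) = d;
  sol_deriv : forall t k, 0 < t < T ->
    is_derive t 1 (fun s => fourier (u s) k) (ut t k);
  sol_duhamel : forall t k, 0 <= t <= T ->
    fourier (u t) k =
      cos (t * jap k) * d.1 k + sin (t * jap k) / jap k * d.2 k
      - \int[lebesgue_measure]_(s in `[0, t])
          (sin ((t - s) * jap k) / jap k * fourier (fun x => u s x ^+ 3) k)
}.

(* [flow t d v] : the solution with data [d] exists on [0, t], and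
   Phi(t)(d) = v. *)
Definition flow (t : R) (d v : phase) : Prop :=
  exists u ut, strong_solution t d u ut /\ v = (fourier (u t), ut t).

Definition flow_defined_on (t : R) (A : set phase) : Prop :=
  forall d, A d -> exists v, flow t d v.

Definition flow_image (t : R) (A : set phase) : set phase :=
  [set v | exists2 d, A d & flow t d v].

End Torus.

(* Main.v *)
Require Import Defs.
From HB Require Import structures.
From mathcomp Require Import all_boot all_order all_algebra.
From mathcomp Require Import all_classical all_reals all_analysis.
From mathcomp Require Import measurable_realfun ring lra zify.
Import Order.TTheory GRing.Theory Num.Theory.
Import numFieldNormedType.Exports.
Local Open Scope classical_set_scope.
Local Open Scope ring_scope.

(** Data in the projected ball are trigonometric polynomials, whose degree and
    coefficients are bounded in terms of N and u_star only, once N is chosen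
    larger than the radius rad. For such data the solution can be written down
    as a power series in time, u(t, x) = sum_n t^n u_n(x), where the u_n are
    the trigonometric polynomials given by

      (n + 1) (n + 2) u_{n+2} = (Delta - 1) u_n - sum_{i+j+k=n} u_i u_j u_k.

    By induction u_n has frequencies at most (n + 1) N. So Delta costs a factor
    of order (n + 1)^2 N^2, which (n + 1) (n + 2) compensates; the same holds
    for the number of terms of the sum. Hence the sum of the amplitudes of u_n
    is at most M rho^n, where M and rho depend on N and u_star only
    ([kg_coef_bounds]).

    For |t| of the order of 1 / rho all series converge geometrically. Fourier
    coefficients may be computed termwise ([fourier_psum]), so each of them is
    a power series in t and solves the equation of an oscillator of frequency
    <k> forced by the coefficient of - u^3. Duhamel's formula is then the
    variation of constants ([oscillator_duhamel]). Since the amplitudes of u_n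
    may be summed with the weight <k> at the price of a factor of order n + 1,
    the same series bound the Sobolev norms of u and of its time derivative and
    show that they depend continuously on t ([kg_strong_solution]). They also
    show that each Fourier coefficient of u moves by at most L t, where L
    depends on N and u_star only ([local_existence]).

    Non-squeezing follows for short times. Move the coefficient of u_star at
    frequency k0, in its first component, by rad <k0>^(-1/2) in both directions.
    This gives two points of the ball. If their images at time t were in the
    cylinder, the first components of these images would have coefficients at
    k0 at distance at most 2 r <k0>^(-1/2). But this distance is at least
    2 rad <k0>^(-1/2) - 2 L t, a contradiction as soon as
    <k0>^(1/2) L t <= eta < rad - r. *)

Set Implicit Arguments.
Unset Strict Implicit.
Unset Printing Implicit Defensive.

(** * Power series with geometrically bounded coefficients *)

Section PowerSeries.
Variable R : realType.
Implicit Types (c a b : nat -> R) (B r t : R).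

Definition geo B r c := forall n, `|c n| <= B * r ^+ n.

Definition psum c t : R := limn (pseries c t).

Lemma geo_ge0 B r c : geo B r c -> 0 <= B.
Proof. by move/(_ 0%N); rewrite expr0 mulr1; apply: le_trans. Qed.

Lemma geo_term B r c t n : 0 <= r -> `|t| * r <= 2^-1 -> geo B r c ->
  `|c n * t ^+ n| <= B * 2^-1 ^+ n.
Proof.
move=> r0 tr hc; rewrite normrM normrX.
apply: (@le_trans _ _ (B * r ^+ n * `|t| ^+ n)).
  by rewrite ler_wpM2r// exprn_ge0.
rewrite -mulrA -exprMn ler_wpM2l ?(geo_ge0 hc)//.
by apply: lerXn2r; rewrite ?nnegrE ?mulr_ge0// mulrC.
Qed.

Lemma half_sum_le B m n : 0 <= B ->
  \sum_(m <= i < n) B * 2^-1 ^+ i <= 2 * B * 2^-1 ^+ m :> R.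
Proof.
move=> B0; have [nm|mn] := leqP n m.
  by rewrite big_geq// mulr_ge0 ?exprn_ge0// mulr_ge0.
suff -> : \sum_(m <= i < n) B * 2^-1 ^+ i =
    2 * B * 2^-1 ^+ m - 2 * B * 2^-1 ^+ n.
  by rewrite gerBl mulr_ge0 ?exprn_ge0// mulr_ge0.
rewrite (eq_bigr (fun i => - (2 * B * 2^-1 ^+ i.+1 - 2 * B * 2^-1 ^+ i))).
  by rewrite sumrN telescope_sumr ?opprB// ltnW.
by move=> i _; rewrite exprS; field.
Qed.

Lemma geo_block B r c t m n : 0 <= r -> `|t| * r <= 2^-1 -> geo B r c ->
  \sum_(m <= i < n) `|c i * t ^+ i| <= 2 * B * 2^-1 ^+ m.
Proof.
move=> r0 tr hc; apply: le_trans (half_sum_le _ _ (geo_ge0 hc)).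
by apply: ler_sum => i _; exact: geo_term hc.
Qed.

Lemma geo_cvg B r c t : 0 <= r -> `|t| * r <= 2^-1 -> geo B r c ->
  pseries c t @ \oo --> psum c t.
Proof.
move=> r0 tr hc; rewrite /psum /pseries; apply: normed_cvg.
apply: nondecreasing_is_cvgn.
  by apply: nondecreasing_series => n _ _; exact: normr_ge0.
exists (2 * B) => _ [n _ <-]; have := geo_block 0 n r0 tr hc.
by rewrite expr0 mulr1.
Qed.

Lemma pseries_sub c t m n : (m <= n)%N ->
  pseries c t n - pseries c t m = \sum_(m <= i < n) c i * t ^+ i.
Proof. by move=> mn; rewrite /pseries/= sub_series_geq. Qed.

(** The error does not depend on the sequence, only on its bound: this is what
    allows to integrate a series of functions termwise. *)
Lemma geo_rem B r c t m : 0 <= r -> `|t| * r <= 2^-1 -> geo B r c ->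
  `|psum c t - pseries c t m| <= 2 * B * 2^-1 ^+ m.
Proof.
move=> r0 tr hc; have cv := geo_cvg r0 tr hc.
have cvN : `|pseries c t n - pseries c t m| @[n --> \oo] -->
    `|psum c t - pseries c t m|.
  by apply: cvg_norm; apply: cvgB => //; exact: cvg_cst.
rewrite -(cvg_lim _ cvN)//; apply: limr_le; first by apply/cvg_ex; eexists;
  exact: cvN.
near=> n; have mn : (m <= n)%N by near: n; exact: nbhs_infty_ge.
rewrite pseries_sub//; apply: le_trans (ler_norm_sum _ _ _) _.
exact: geo_block hc.
Unshelve. all: by end_near. Qed.

Lemma geo_le B r c t : 0 <= r -> `|t| * r <= 2^-1 -> geo B r c ->
  `|psum c t| <= 2 * B.
Proof.
move=> r0 tr hc; have := geo_rem 0 r0 tr hc.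
by rewrite expr0 mulr1 /pseries/= /series/= big_geq// subr0.
Qed.

Lemma nat_le_exp2 n : n.+1%:R <= 2 ^+ n :> R.
Proof. by rewrite -natrX ler_nat ltn_expl. Qed.

(** Doubling the ratio absorbs the factor n + 1, so that polynomial growth
    never has to be recorded. *)
Lemma geo_diffs B r c : 0 <= r -> geo B r c ->
  geo (B * r) (2 * r) (pseries_diffs c).
Proof.
move=> r0 hc n; rewrite /pseries_diffs normrM ger0_norm//.
apply: (@le_trans _ _ (2 ^+ n * (B * r ^+ n.+1))).
  by apply: ler_pM => //; exact: nat_le_exp2.
by rewrite exprMn exprS le_eqVlt; apply/orP; left; apply/eqP; ring.
Qed.

(** Termwise differentiation needs the convergence of the second derived
    series, whose ratio is 4 r, at a point farther than t: 1 / (8 r) will do. *)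
Lemma geo_derive B r c t : 0 < r -> `|t| * (8 * r) < 1 -> geo B r c ->
  is_derive t 1 (psum c) (psum (pseries_diffs c) t).
Proof.
move=> r0 tr hc; have r0' := ltW r0.
have h1 := geo_diffs r0' hc; have h2 := geo_diffs (mulr_ge0 (ler0n _ 2) r0') h1.
have K0 : 0 <= (8 * r)^-1 by rewrite invr_ge0 mulr_ge0.
have KE : `|(8 * r)^-1| * (8 * r) = 1.
  by rewrite ger0_norm// mulVf// mulf_neq0// gt_eqF.
apply: (@pseries_snd_diffs _ c (8 * r)^-1).
- by apply/cvg_ex; eexists; apply: (geo_cvg r0' _ hc); lra.
- by apply/cvg_ex; eexists; apply: (geo_cvg _ _ h1); lra.
- by apply/cvg_ex; eexists; apply: (geo_cvg _ _ h2); lra.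
- by rewrite [ltRHS]ger0_norm// -[ltRHS]div1r ltr_pdivlMr// mulr_gt0.
Qed.

Definition cauchy_prod a b n : R := \sum_(i < n.+1) a i * b (n - i)%N.

Lemma geo_conv A B r a b : 0 <= r -> geo A r a -> geo B r b ->
  geo (A * B) (2 * r) (cauchy_prod a b).
Proof.
move=> r0 ha hb n; rewrite /cauchy_prod; apply: le_trans (ler_norm_sum _ _ _) _.
apply: (@le_trans _ _ (\sum_(i < n.+1) A * B * r ^+ n)).
  apply: ler_sum => i _; rewrite normrM.
  have -> : A * B * r ^+ n = (A * r ^+ i) * (B * r ^+ (n - i)).
    by rewrite mulrACA -exprD subnKC// -ltnS.
  exact: ler_pM.
rewrite sumr_const card_ord -[leLHS]mulr_natl exprMn [leRHS]mulrCA ler_wpM2r//.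
  by rewrite !mulr_ge0 ?exprn_ge0 ?(geo_ge0 ha) ?(geo_ge0 hb).
exact: nat_le_exp2.
Qed.

Lemma conv_sum (x y : nat -> R) m :
  \sum_(0 <= n < m) cauchy_prod x y n
    = \sum_(i < m) x i * \sum_(0 <= j < m - i) y j.
Proof.
elim: m => [|m IH]; first by rewrite big_geq// big_ord0.
rewrite big_nat_recr//= IH /cauchy_prod [in RHS]big_ord_recr/= [in
  LHS]big_ord_recr/=.
rewrite subnn subSn// subnn big_nat1 addrA -big_split/=; congr (_ + _).
apply: eq_bigr => i _; rewrite subSn ?(ltnW (ltn_ord i))//.
by rewrite big_nat_recr//= mulrDr.
Qed.

Lemma conv_pseries a b t m : pseries (cauchy_prod a b) t m =
  \sum_(i < m) (a i * t ^+ i) * \sum_(0 <= j < m - i) (b j * t ^+ j).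
Proof.
rewrite -(conv_sum (fun i => a i * t ^+ i) (fun j => b j * t ^+ j)).
rewrite /pseries /series/=; apply: eq_bigr => n _.
rewrite /cauchy_prod mulr_suml; apply: eq_bigr => i _.
by rewrite mulrACA -exprD subnKC// -ltnS.
Qed.

(** The product of the m-th partial sums differs from the m-th partial sum of the
    Cauchy product by terms of indices i, j < m with i + j >= m.
    As |t| r <= 1/4,
    for a given i they add up to at most 2 A B 4^(-m), and there are m values
    of i. *)
Lemma psum_conv A B r a b t : 0 <= r -> `|t| * (2 * r) <= 2^-1 ->
  geo A r a -> geo B r b -> psum (cauchy_prod a b) t = psum a t * psum b t.
Proof.
move=> r0 tr ha hb.
have tr' : `|t| * r <= 2^-1 by have := mulr_ge0 (normr_ge0 t) r0; lra.
have A0 := geo_ge0 ha; have B0 := geo_ge0 hb.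
have cP : (pseries a t n * pseries b t n) @[n --> \oo] --> psum a t * psum b t.
  by apply: cvgM; [apply: geo_cvg ha|apply: geo_cvg hb].
have r20 : 0 <= 2 * r by lra.
have cC := geo_cvg r20 tr (geo_conv r0 ha hb).
have cD : (pseries a t n * pseries b t n - pseries (cauchy_prod a b) t n) @[n
  --> \oo] -->
   psum a t * psum b t - psum (cauchy_prod a b) t by exact: cvgB.
apply/esym/eqP; rewrite -subr_eq0; apply/eqP; apply: cvg_unique cD _ => //.
apply: (@squeeze_cvgr _ _ _ _ (fun n => - geometric (2 * A * B) 2^-1 n)
  (geometric (2 * A * B) 2^-1)); last 2 first.
- rewrite -oppr0; apply: cvgN; apply: cvg_geometric.
  by rewrite ger0_norm// invf_lt1// ltr1n.
- by apply: cvg_geometric; rewrite ger0_norm// invf_lt1// ltr1n.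
near=> m; rewrite -ler_norml conv_pseries.
rewrite {1}/pseries /series/= big_mkord mulr_suml -sumrB.
apply: le_trans (ler_norm_sum _ _ _) _.
apply: (@le_trans _ _ (\sum_(i < m) (2 * A * B) * (4^-1) ^+ m)); last first.
  rewrite sumr_const card_ord -[leLHS]mulr_natl mulrCA ler_wpM2l ?mulr_ge0//.
  have -> : (4^-1 : R) = 2^-1 * 2^-1 by field.
  rewrite exprMn mulrA ler_piMl ?exprn_ge0// exprVn.
  rewrite ler_pdivrMr ?exprn_gt0// mul1r (le_trans _ (nat_le_exp2 m))//.
  by rewrite ler_nat.
apply: ler_sum => i _; rewrite -mulrBr.
have /pseries_sub -> : (m - i <= m)%N by exact: leq_subr.
rewrite normrM.
have -> : 2 * A * B * 4^-1 ^+ m =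
    (A * 4^-1 ^+ i) * (2 * B * 4^-1 ^+ (m - i)).
  rewrite mulrACA -exprD subnKC ?(ltnW (ltn_ord i))//; ring.
apply: ler_pM => //.
  rewrite normrM normrX; apply: (@le_trans _ _ (A * r ^+ i * `|t| ^+ i)).
    by rewrite ler_wpM2r// exprn_ge0.
  rewrite -mulrA -exprMn ler_wpM2l//; apply: lerXn2r;
    rewrite ?nnegrE ?mulr_ge0//.
  by rewrite mulrC; lra.
apply: le_trans (ler_norm_sum _ _ _) _.
apply: (@le_trans _ _
  (\sum_(m - i <= k < m) (B * 2^-1 ^+ (m - i)) * 2^-1 ^+ k)).
  rewrite big_nat_cond [leRHS]big_nat_cond;
    apply: ler_sum => k /andP[/andP[hk _] _].
  rewrite normrM normrX; apply: (@le_trans _ _ (B * r ^+ k * `|t| ^+ k)).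
    by rewrite ler_wpM2r// exprn_ge0.
  rewrite -!mulrA -exprMn ler_wpM2l//.
  apply: (@le_trans _ _ (4^-1 ^+ k)).
    by apply: lerXn2r; rewrite ?nnegrE ?mulr_ge0//; rewrite mulrC; lra.
  have -> : (4^-1 : R) = 2^-1 * 2^-1 by field.
  rewrite exprMn ler_wpM2r ?exprn_ge0// -[leLHS]mul1r.
  by rewrite mul1r ler_wiXn2l// invf_le1// ler1n.
apply: le_trans (half_sum_le _ _ _) _; first by rewrite mulr_ge0// exprn_ge0.
have -> : (4^-1 : R) = 2^-1 * 2^-1 by field.
by rewrite exprMn !mulrA.
Unshelve. all: by end_near. Qed.

Lemma cvg_norm_le (u : nat -> R) (l C : R) : u @ \oo --> l ->
  (forall m, `|u m| <= C) -> `|l| <= C.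
Proof.
move=> ul uC; have cn : `|u m| @[m --> \oo] --> `|l| by exact: cvg_norm.
rewrite -(cvg_lim _ cn)//; apply: limr_le; first by apply/cvg_ex; eexists;
  exact: cn.
by near=> m.
Unshelve. all: by end_near. Qed.

Lemma geoW B r r' c : 0 <= r <= r' -> geo B r c -> geo B r' c.
Proof.
move=> /andP[r0 rr'] hc n; apply: le_trans (hc n) _.
by rewrite ler_wpM2l ?(geo_ge0 hc)// lerXn2r// nnegrE// (le_trans r0).
Qed.

Lemma geoZ B r c (x : R) : geo B r c -> geo (`|x| * B) r (fun n => x * c n).
Proof. by move=> hc n; rewrite normrM -mulrA ler_wpM2l. Qed.

Lemma geo_norm B r c : geo B r c -> geo B r (fun n => `|c n|).
Proof. by move=> hc n; rewrite normr_id. Qed.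

Lemma psum0 c : psum c 0 = c 0%N.
Proof.
apply/cvg_lim => //; apply: cvg_near_cst; near=> m.
have m0 : (0 < m)%N by near: m; exact: nbhs_infty_gt.
rewrite /pseries /series/= -(prednK m0) big_nat_recl// expr0 mulr1.
by rewrite big1 ?addr0// => i _; rewrite exprS mul0r mulr0.
Unshelve. all: by end_near. Qed.

Lemma psumD B B' r c c' t : 0 <= r -> `|t| * r <= 2^-1 ->
  geo B r c -> geo B' r c' ->
  psum (fun n => c n + c' n) t = psum c t + psum c' t.
Proof.
move=> r0 tr hc hc'; apply/cvg_lim => //.
have -> : pseries (fun n => c n + c' n) t =
    (fun m => pseries c t m + pseries c' t m).
  apply/funext => m; rewrite /pseries /series/= -big_split/=.
  by apply: eq_bigr => i _; rewrite mulrDl.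
by apply: cvgD; [exact: geo_cvg hc|exact: geo_cvg hc'].
Qed.

Lemma psumZ B r c (x : R) t : 0 <= r -> `|t| * r <= 2^-1 -> geo B r c ->
  psum (fun n => x * c n) t = x * psum c t.
Proof.
move=> r0 tr hc; apply/cvg_lim => //.
have -> : pseries (fun n => x * c n) t = (fun m => x * pseries c t m).
  apply/funext => m; rewrite /pseries /series/= mulr_sumr.
  by apply: eq_bigr => i _; rewrite mulrA.
by apply: cvgMr; exact: geo_cvg hc.
Qed.

Lemma psum_sum (I : Type) (F : seq I) (B : I -> R) r (c : I -> nat -> R) t :
  0 <= r -> `|t| * r <= 2^-1 -> (forall i, geo (B i) r (c i)) ->
  psum (fun n => \sum_(i <- F) c i n) t = \sum_(i <- F) psum (c i) t.
Proof.
move=> r0 tr hc; apply/cvg_lim => //.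
have -> : pseries (fun n => \sum_(i <- F) c i n) t =
    (fun m => \sum_(i <- F) pseries (c i) t m).
  apply/funext => m; rewrite /pseries /series/= exchange_big/=.
  by apply: eq_bigr => n _; rewrite mulr_suml.
apply: cvg_big => [|i _]; first exact: add_continuous.
exact: geo_cvg (hc i).
Qed.

(** The sum of |c_n| (4 T)^n dominates the series and its derivative on [-T, T],
    together with their difference quotients: each of these operations costs
    at most factors n and 1 / T, and two factors n <= 2^n are absorbed by 4^n.
    A single majorant thus serves for all the Sobolev estimates. *)
Section Domination.
Variables (c : nat -> R) (B r T : R).
Hypothesis r0 : 0 < r.
Hypothesis T0 : 0 < T.
Hypothesis Tr : 4 * T * (8 * r) <= 2^-1.
Hypothesis hc : geo B r c.
Let gam := psum (fun n => `|c n|) (4 * T).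

Let radius_le t q : 0 <= q <= 8 -> `|t| <= T -> `|t| * (q * r) <= 2^-1.
Proof.
move=> /andP[q0 q8] tT; apply: le_trans Tr.
apply: ler_pM => //; first by rewrite mulr_ge0// ltW.
  by rewrite (le_trans tT)//; have := ltW T0; lra.
by rewrite ler_wpM2r// ltW.
Qed.

Let radius1 t : `|t| <= T -> `|t| * r <= 2^-1.
Proof. by move=> tT; rewrite -[X in _ * X]mul1r radius_le//; lra. Qed.

Lemma dominating_partial m : \sum_(0 <= n < m) `|c n| * (4 * T) ^+ n <= gam.
Proof.
have tr : `|4 * T| * r <= 2^-1.
  rewrite ger0_norm ?mulr_ge0 ?(ltW T0)//; apply: le_trans Tr.
  have := mulr_gt0 T0 r0; nra.
apply: (@nondecreasing_cvgn_le _ (pseries (fun n => `|c n|) (4 * T))).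
  apply: nondecreasing_series => n _ _.
  by rewrite mulr_ge0// exprn_ge0// mulr_ge0// ltW.
by apply/cvg_ex; eexists; apply: geo_cvg (geo_norm hc) => //; exact: ltW.
Qed.

Lemma dominating_ge0 : 0 <= gam.
Proof. by have := dominating_partial 0; rewrite big_geq. Qed.

Let exp_sub (s t : R) n : `|s| <= T -> `|t| <= T ->
  `|s ^+ n - t ^+ n| <= `|s - t| * (n%:R * T ^+ n / T).
Proof.
move=> sT tT; case: n => [|n];
  first by rewrite !expr0 subrr normr0 !mul0r mulr0.
rewrite subrXX normrM ler_wpM2l// exprSr mulrA mulfK ?gt_eqF//.
apply: le_trans (ler_norm_sum _ _ _) _.
rewrite mulr_natl -[X in _ *+ X]card_ord -sumr_const; apply: ler_sum => i _.
rewrite normrM !normrX.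
have -> : T ^+ n = T ^+ (n - i) * T ^+ i by rewrite -exprD subnK// -ltnS.
by rewrite ler_pM ?exprn_ge0// lerXn2r// nnegrE ltW.
Qed.

Let nat_le_2 n : n%:R <= 2 ^+ n :> R.
Proof. by rewrite -natrX ler_nat ltnW// ltn_expl. Qed.

Lemma psum_dom t : `|t| <= T -> `|psum c t| <= gam.
Proof.
move=> tT; apply: (cvg_norm_le (geo_cvg (ltW r0) (radius1 tT) hc)) => m.
apply: le_trans (dominating_partial m); apply: le_trans (ler_norm_sum _ _ _) _.
apply: ler_sum => n _; rewrite normrM normrX ler_wpM2l// lerXn2r ?nnegrE//.
  by rewrite mulr_ge0// ltW.
by rewrite (le_trans tT)//; have := ltW T0; lra.
Qed.

Lemma psum_lip s t : `|s| <= T -> `|t| <= T ->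
  `|psum c s - psum c t| <= `|s - t| / T * gam.
Proof.
move=> sT tT.
have cv : (pseries c s m - pseries c t m) @[m --> \oo] --> psum c s - psum c t.
  by apply: cvgB; apply: (geo_cvg (ltW r0) _ hc); exact: radius1.
apply: (cvg_norm_le cv) => m.
apply: le_trans (ler_wpM2l _ (dominating_partial m)); last first.
  by rewrite divr_ge0// ltW.
rewrite /pseries /series/= -sumrB mulr_sumr.
apply: le_trans (ler_norm_sum _ _ _) _; apply: ler_sum => n _.
rewrite -mulrBr normrM mulrCA ler_wpM2l//.
apply: le_trans (exp_sub n sT tT) _; rewrite -[leRHS]mulrA ler_wpM2l//.
rewrite mulrC ler_wpM2l ?invr_ge0 ?(ltW T0)// exprMn ler_wpM2r ?exprn_ge0
  ?(ltW T0)//.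
by apply: le_trans (nat_le_2 n) _; rewrite lerXn2r ?nnegrE// ler_nat.
Qed.

Let diffs_geo : geo (B * r) (2 * r) (pseries_diffs c).
Proof. exact: geo_diffs (ltW r0) hc. Qed.

Let diffs_cvg t : `|t| <= T ->
  pseries (pseries_diffs c) t @ \oo --> psum (pseries_diffs c) t.
Proof.
move=> tT; apply: geo_cvg diffs_geo; first by rewrite mulr_ge0// ltW.
by apply: radius_le => //; lra.
Qed.

Let shifted_partial m :
  \sum_(0 <= n < m) `|c n.+1| * (4 * T) ^+ n.+1 <= gam.
Proof.
apply: le_trans (dominating_partial m.+1).
by rewrite big_nat_recl// lerDr mulr_ge0// exprn_ge0// mulr_ge0// ltW.
Qed.

Lemma psum_diffs_dom t : `|t| <= T -> `|psum (pseries_diffs c) t| <= T^-1 * gam.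
Proof.
move=> tT; apply: (cvg_norm_le (diffs_cvg tT)) => m.
apply: le_trans (ler_wpM2l _ (shifted_partial m)); last by rewrite invr_ge0 ltW.
rewrite mulr_sumr; apply: le_trans (ler_norm_sum _ _ _) _.
apply: ler_sum => n _; rewrite /pseries_diffs !normrM normrX ger0_norm//.
rewrite [n.+1%:R * _]mulrC -mulrA [leRHS]mulrCA ler_wpM2l//.
rewrite exprMn [_ ^+ n.+1 * _]mulrC mulrA exprS mulKf ?gt_eqF//.
rewrite mulrC; apply: ler_pM; rewrite ?exprn_ge0//.
  by rewrite lerXn2r// nnegrE ltW.
by apply: le_trans (nat_le_2 n.+1) _; rewrite lerXn2r ?nnegrE// ler_nat.
Qed.

Lemma psum_diffs_lip s t : `|s| <= T -> `|t| <= T ->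
  `|psum (pseries_diffs c) s - psum (pseries_diffs c) t| <=
  `|s - t| / T ^+ 2 * gam.
Proof.
move=> sT tT; pose d := pseries_diffs c.
have cv : (pseries d s m - pseries d t m) @[m --> \oo] --> psum d s - psum d t.
  by apply: cvgB; exact: diffs_cvg.
apply: (cvg_norm_le cv) => m.
apply: le_trans (ler_wpM2l _ (shifted_partial m)); last first.
  by rewrite divr_ge0// exprn_ge0// ltW.
rewrite /pseries /series/= -sumrB mulr_sumr.
apply: le_trans (ler_norm_sum _ _ _) _; apply: ler_sum => n _.
rewrite -mulrBr normrM /pseries_diffs normrM ger0_norm//.
rewrite [n.+1%:R * _]mulrC -mulrA [leRHS]mulrCA ler_wpM2l//.
apply: le_trans (ler_wpM2l (ler0n _ n.+1) (exp_sub n sT tT)) _.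
rewrite mulrCA -[leRHS]mulrA ler_wpM2l//.
have -> : n.+1%:R * (n%:R * T ^+ n / T)
  = (T ^+ 2)^-1 * (n.+1%:R * n%:R * T ^+ n.+1).
  by rewrite (exprS T n); field; rewrite gt_eqF.
rewrite ler_wpM2l ?invr_ge0 ?exprn_ge0 ?(ltW T0)// exprMn ler_wpM2r ?exprn_ge0
  ?(ltW T0)//.
have -> : (4 : R) = 2 * 2 by ring.
rewrite exprMn; apply: ler_pM => //.
by apply: (@le_trans _ _ n.+1%:R) => //; rewrite ler_nat.
Qed.

End Domination.
End PowerSeries.

(** * The forced harmonic oscillator *)

Lemma is_derive_continuous (R : realType) (f : R -> R) (x df : R) :
  is_derive x 1 f df -> {for x, continuous f}.
Proof. by case=> fx _; apply: differentiable_continuous;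
  exact/derivable1_diffP. Qed.

Lemma FTC2_is_derive (R : realType) (f F : R -> R) (a b : R) : a <= b ->
  (forall s, a <= s <= b -> is_derive s 1 F (f s)) ->
  (forall s, a <= s <= b -> {for s, continuous f}) ->
  \int[lebesgue_measure]_(s in `[a, b]) f s = F b - F a.
Proof.
rewrite le_eqVlt => /predU1P[<- _ _|ab dF cf].
  by rewrite set_itv1 Rintegral_set1 subrr.
have cF s : a <= s <= b -> {for s, continuous F}.
  by move=> sab; apply: is_derive_continuous; exact: dF.
rewrite /Rintegral (@continuous_FTC2 _ _ F)//.
- apply: continuous_in_subspaceT => s; rewrite inE/= in_itv/=; exact: cf.
- split=> [s||].
  + by rewrite in_itv/= => /andP[s1 s2]; have [] := dF s; rewrite ?ltW.
  + by apply: cvg_at_right_filter; apply: cF; rewrite lexx ltW.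
  + by apply: cvg_at_left_filter; apply: cF; rewrite lexx ltW.
- move=> s; rewrite in_itv/= => /andP[s1 s2]; rewrite derive1E.
  by apply: derive_val; apply: dF; rewrite !ltW.
Qed.

(** Variation of constants: if a'' + j^2 a = - f, then the function
    s |-> cos((t-s)j) a(s) + j^-1 sin((t-s)j) a'(s) has derivative
    - j^-1 sin((t-s)j) f(s). *)
Lemma oscillator_duhamel (R : realType) (a a1 f : R -> R) (j t : R) :
  j != 0 -> 0 <= t ->
  (forall s : R, 0 <= s <= t -> is_derive s 1 a (a1 s)) ->
  (forall s : R, 0 <= s <= t -> is_derive s 1 a1 (- (j ^+ 2 * a s) - f s)) ->
  (forall s : R, 0 <= s <= t -> {for s, continuous f}) ->
  a t = cos (t * j) * a 0 + sin (t * j) / j * a1 0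
    - \int[lebesgue_measure]_(s in `[0, t]) (sin ((t - s) * j) / j * f s).
Proof.
move=> j0 t0 da da1 cf.
pose F s := - (cos ((t - s) * j) * a s + sin ((t - s) * j) / j * a1 s).
have dl (s : R) : is_derive s (1 : R) (fun x : R => (t - x) * j) (- j).
  rewrite (_ : (fun _ => _) = j \*: (cst t - id)); last first.
    by apply/funext => x; rewrite /GRing.scale/= mulrC.
  by apply: is_derive_eq; rewrite /GRing.scale/= sub0r mulrN1.
have dc (s : R) : is_derive s (1 : R) (fun x : R => cos ((t - x) * j)) (sin
  ((t - s) * j) * j).
  apply: (is_derive_eq (is_derive1_comp (is_derive_cos _) (dl s))).
  by rewrite mulrNN.
have ds (s : R) : is_derive s (1 : R) (fun x : R => sin ((t - x) * j)) (- (cos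
  ((t - s) * j) * j)).
  apply: (is_derive_eq (is_derive1_comp (is_derive_sin _) (dl s))).
  by rewrite mulrN.
have cs (s : R) : {for s, continuous (fun x : R => sin ((t - x) * j))}.
  exact: is_derive_continuous (ds s).
have dF (s : R) : 0 <= s <= t -> is_derive s 1 F (sin ((t - s) * j) / j * f s).
  move=> st.
  have := is_deriveN (is_deriveD (is_deriveM (dc s) (da _ st))
    (is_deriveM (is_deriveZ j^-1 (ds s)) (da1 _ st))).
  rewrite (_ : - _ = F); last first.
    apply/funext => x; by rewrite /F /= (mulrC (sin _)).
  move/is_derive_eq; apply;
    rewrite /GRing.scale/= (_ : j^-1 *: _ = j^-1 * sin ((t - s) * j))//.
  by field.
have cF : forall s : R, 0 <= s <= t ->
    {for s, continuous (fun x : R => sin ((t - x) * j) / j * f x)}.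
  move=> s st; apply: cvgM; last exact: cf.
  by apply: cvgMl; exact: cs.
have -> := FTC2_is_derive t0 dF cF.
by rewrite /F subrr subr0 mul0r sin0 cos0 mul0r mul0r mul1r; ring.
Qed.

(** * Fourier coefficients on the torus *)

Lemma sin_periodic_int (R : realType) (x : R) (m : int) :
  sin (x + m%:~R * (2 * pi)) = sin x.
Proof.
have nat_case (n : nat) (y : R) : sin (y + n%:R * (2 * pi)) = sin y.
  by rewrite -[RHS](periodicn (@sinD2pi R) n y) -(mulr_natl pi) -(mulr_natl (_
    * _) n).
case: m => n; first exact: nat_case.
rewrite -[LHS](nat_case n.+1) NegzE mulrNz mulNr; congr sin; ring.
Qed.

Lemma Rintegral_prod d1 d2 (T1 : measurableType d1) (T2 : measurableType d2)
    (R : realType) (m1 : {sigma_finite_measure set T1 -> \bar R})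
    (m2 : {sigma_finite_measure set T2 -> \bar R}) (A : set T1) (B : set T2)
    (f : T1 * T2 -> R) :
  measurable A -> measurable B -> (m1 A < +oo)%E -> (m2 B < +oo)%E ->
  measurable_fun setT f -> [bounded f x | x in setT] ->
  \int[(m1 \x m2)%E]_(p in A `*` B) f p =
  \int[m1]_(x in A) \int[m2]_(y in B) f (x, y).
Proof.
move=> mA mB fA fB mf bf.
have mAB : measurable (A `*` B) by exact: measurableX.
have fAB : ((m1 \x m2) (A `*` B) < +oo)%E.
  by rewrite product_measure1E//= lte_mul_pinfty// ge0_fin_numE.
have intf : (m1 \x m2)%E.-integrable (A `*` B) (EFin \o f).
  apply: measurable_bounded_integrable => //.
    exact: measurable_funS mf.
  move: bf => [M [Mr hM]]; exists M; split => // x Mx y ABy; exact: hM.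
rewrite /Rintegral; congr fine.
rewrite integral_mkcond -integral12_prod_meas1; last first.
  exact/(integrable_mkcond _ mAB).
rewrite [RHS]integral_mkcond; apply: eq_integral => x _.
rewrite /fubini_F /= patchE; case: ifPn => xA; last first.
  apply: integral0_eq => y _; rewrite patchE ifF//.
  by apply/negbTE; rewrite notin_setE => -[/= Ax _]; move/negP: xA; rewrite inE.
have intx : m2.-integrable B (fun y => (f (x, y))%:E).
  apply: (@measurable_bounded_integrable _ _ _ _ (fun y => f (x, y))) => //.
    apply: (@measurable_funS _ _ _ _ setT) => //.
    exact: measurableT_comp mf (measurable_pair1 _).
  move: bf => [M [Mr hM]]; exists M; split => // z Mz y By; exact: hM.
rewrite fineK; last exact: integrable_fin_num.
rewrite [RHS]integral_mkcond; apply: eq_integral => y _.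
rewrite !patchE; suff -> : ((x, y) \in A `*` B) = (y \in B) by [].
move: xA; rewrite inE => Ax; apply/idP/idP; rewrite !inE; first by case.
by move=> By; split.
Qed.

Section TorusIntegral.
Variable R : realType.
Local Notation R1 := (measurableTypeR R).
Local Notation R3 := (R1 * R1 * R1)%type.
Local Notation circle := (`[0, 2 * pi[%classic : set R1).
Local Notation vol := ((2 * pi) ^+ 3 : R).

Lemma two_pi_gt0 : 0 < 2 * pi :> R.
Proof. by rewrite mulr_gt0// pi_gt0. Qed.

Lemma leb1_circle : @leb1 R circle = (2 * pi)%:E.
Proof.
by rewrite /leb1/= lebesgue_measure_itv/= lte_fin two_pi_gt0 -EFinD subr0.
Qed.

Lemma leb2_circle : @leb2 R (circle `*` circle) = ((2 * pi) ^+ 2)%:E.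
Proof. by rewrite /leb2 product_measure1E//= leb1_circle -EFinM -expr2. Qed.

Lemma measurable_torus : measurable (@torus R).
Proof. by apply: measurableX => //; apply: measurableX. Qed.

Lemma leb3_torus : @leb3 R (@torus R) = vol%:E.
Proof.
rewrite /leb3 /torus product_measure1E//=; last by apply: measurableX.
by rewrite leb1_circle leb2_circle -EFinM -exprSr.
Qed.

Lemma integral_cos_circle (m : int) (c : R) :
  \int[@leb1 R]_(x in circle) cos (m%:~R * x + c) =
  if m == 0 then 2 * pi * cos c else 0.
Proof.
have dl (s : R) : is_derive s (1 : R) (fun x : R => m%:~R * x + c) m%:~R.
  rewrite (_ : (fun _ => _) = m%:~R \*: id + cst c); last exact/funext.
  by apply: is_derive_eq; rewrite /GRing.scale/= mulr1 addr0.
have cc (s : R) : {for s, continuous (fun x : R => cos (m%:~R * x + c))}.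
  apply: is_derive_continuous; exact: is_derive1_comp (is_derive_cos _) (dl s).
rewrite /leb1 Rintegral_itv_bndo_bndc; last first.
  apply: (@measurable_bounded_integrable _ _ _ _ (fun x : R1 => cos (m%:~R * x
    + c))) => //.
  - by have := leb1_circle; rewrite /leb1 /= => ->; rewrite ltry.
  - apply: (@measurable_funS _ _ _ _ setT) => //.
    by apply: continuous_measurable_fun => s; exact: cc.
  - by exists 1; split => // M M1 x _; rewrite /= (le_trans (cos_max _))// ltW.
have [->|m0] := eqVneq m 0.
  under eq_Rintegral do rewrite mul0r add0r.
  rewrite Rintegral_cst//= lebesgue_measure_itv/= lte_fin two_pi_gt0.
  by rewrite -EFinD subr0/= mulrC.
have mR : m%:~R != 0 :> R by rewrite intr_eq0.
have dF (s : R) : 0 <= s <= 2 * pi ->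
   is_derive s (1 : R) (m%:~R^-1 \*: (fun x : R => sin (m%:~R * x + c)))
   (cos (m%:~R * s + c)).
  move=> _; apply: (is_derive_eq (is_deriveZ _ (is_derive1_comp (is_derive_sin
    _) (dl s)))).
  by rewrite /GRing.scale/= mulrC mulfK.
have -> := FTC2_is_derive (ltW two_pi_gt0) dF (fun s _ => cc s).
by rewrite /= mulr0 add0r (addrC _ c) sin_periodic_int subrr.
Qed.

Lemma measurable_dot (m : Z3) : measurable_fun setT (@dot R m).
Proof.
rewrite /dot; apply: measurable_funD; first apply: measurable_funD.
- apply: measurable_funM => //.
  exact: measurableT_comp measurable_fst measurable_fst.
- apply: measurable_funM => //.
  exact: measurableT_comp measurable_snd measurable_fst.
- by apply: measurable_funM => //; exact: measurable_snd.
Qed.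

Lemma measurable_wave (m : Z3) (c : R) :
  measurable_fun setT (fun x : R3 => cos (dot m x + c)).
Proof.
apply: (measurableT_comp (f := cos)).
  by apply: continuous_measurable_fun; exact: continuous_cos.
by apply: measurable_funD => //; exact: measurable_dot.
Qed.

Lemma integral_cos_torus (m : Z3) (c : R) :
  \int[@leb3 R]_(x in @torus R) cos (dot m x + c) =
  if m == (0, 0, 0) then vol * cos c else 0.
Proof.
have bcos T (h : T -> R) (A : set T) : [bounded cos (h x) | x in A].
  by exists 1; split => // M M1 x _; rewrite /= (le_trans (cos_max _))// ltW.
have mleb1 : (@leb1 R circle < +oo)%E by rewrite leb1_circle ltry.
have mleb2 : (@leb2 R (circle `*` circle) < +oo)%E by rewrite leb2_circle ltry.
case: m => [[m1 m2] m3].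
rewrite [LHS](@Rintegral_prod _ _ _ _ _ (@leb2 R) (@leb1 R))//; last 2 first.
- by apply: measurableX.
- exact: measurable_wave.
have inner (x : R1 * R1) : \int[@leb1 R]_(y in circle)
    cos (dot (m1, m2, m3) (x, y) + c) =
    (if m3 == 0 then 2 * pi else 0) * cos (m1%:~R * x.1 + m2%:~R * x.2 + c).
  transitivity (\int[@leb1 R]_(y in circle)
      cos (m3%:~R * y + (m1%:~R * x.1 + m2%:~R * x.2 + c))).
    by apply: eq_Rintegral => y _; congr cos; rewrite /dot/=; ring.
  by rewrite integral_cos_circle; case: ifP => // _; rewrite mul0r.
under eq_Rintegral do rewrite inner.
have m2D : measurable_fun setT (fun x : R1 * R1 => cos (m1%:~R * x.1 + m2%:~R
  * x.2 + c)).
  apply: (measurableT_comp (f := cos)).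
    by apply: continuous_measurable_fun; exact: continuous_cos.
  apply: measurable_funD => //; apply: measurable_funD.
    by apply: measurable_funM => //; exact: measurable_fst.
  by apply: measurable_funM => //; exact: measurable_snd.
rewrite RintegralZl//; last 2 first.
- by apply: measurableX.
- apply: measurable_bounded_integrable => //; first exact: measurableX.
  exact: measurable_funS m2D.
rewrite [X in _ * X](@Rintegral_prod _ _ _ _ _ (@leb1 R) (@leb1 R))//.
have inner2 (x : R1) : \int[@leb1 R]_(y in circle)
    cos (m1%:~R * x + m2%:~R * y + c) =
    (if m2 == 0 then 2 * pi else 0) * cos (m1%:~R * x + c).
  transitivity (\int[@leb1 R]_(y in circle) cos (m2%:~R * y + (m1%:~R * x +
    c))).
    by apply: eq_Rintegral => y _; congr cos; ring.
  by rewrite integral_cos_circle; case: ifP => // _; rewrite mul0r.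
under eq_Rintegral do rewrite inner2.
rewrite RintegralZl//; last first.
  apply: measurable_bounded_integrable => //.
  apply: (@measurable_funS _ _ _ _ setT) => //.
  apply: (measurableT_comp (f := cos)).
    by apply: continuous_measurable_fun; exact: continuous_cos.
  by apply: measurable_funD => //; exact: measurable_funM.
rewrite integral_cos_circle !xpair_eqE.
by case: eqVneq => _; case: eqVneq => _; case: eqVneq => _ /=; ring.
Qed.
End TorusIntegral.

Section Fourier.
Variable R : realType.
Local Notation R1 := (measurableTypeR R).
Local Notation R3 := (R1 * R1 * R1)%type.
Local Notation vol := ((2 * pi) ^+ 3 : R).
Implicit Types (f g : R3 -> R) (k l : Z3).

Lemma vol_gt0 : 0 < vol.
Proof. by rewrite exprn_gt0// two_pi_gt0. Qed.

Definition bounded_meas (M : R) f :=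
  measurable_fun setT f /\ forall x, `|f x| <= M.

Lemma bounded_meas_integrable M f : bounded_meas M f ->
  (@leb3 R).-integrable (@torus R) (EFin \o f).
Proof.
move=> [mf bf]; apply: measurable_bounded_integrable.
- exact: measurable_torus.
- by rewrite [X in (X < _)%E]leb3_torus ltry.
- exact: measurable_funS mf.
- by exists M; split; [exact: num_real|move=> y My x _;
  rewrite /= (le_trans (bf _))// ltW].
Qed.

Lemma bounded_measM M M' f g : bounded_meas M f -> bounded_meas M' g ->
  bounded_meas (M * M') (fun x => f x * g x).
Proof.
move=> [mf bf] [mg bg]; split; first exact: measurable_funM.
by move=> x; rewrite normrM ler_pM.
Qed.

Lemma bounded_measD M M' f g : bounded_meas M f -> bounded_meas M' g ->
  bounded_meas (M + M') (fun x => f x + g x).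
Proof.
move=> [mf bf] [mg bg]; split; first exact: measurable_funD.
by move=> x; rewrite (le_trans (ler_normD _ _))// lerD.
Qed.

Lemma bounded_measZ M (c : R) f : bounded_meas M f ->
  bounded_meas (`|c| * M) (fun x => c * f x).
Proof. by move=> bf; apply: bounded_measM bf; split => //;
  exact: measurable_cst. Qed.

Lemma bounded_meas_wave l (c : R) : bounded_meas 1 (fun x => cos (dot l x + c)).
Proof. by split; [exact: measurable_wave|move=> x; exact: cos_max]. Qed.

Definition basis_amp k : R :=
  if k == (0, 0, 0) then (Num.sqrt vol)^-1 else Num.sqrt (2 / vol).

(** A sine is a cosine with phase - pi/2, so every basis function is a wave. *)
Definition basis_phase k : R :=
  if (k == (0, 0, 0)) || pos_half k then 0 else - (pi / 2).

Lemma trig_basisE k x : trig_basis k x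
  = basis_amp k * cos (dot k x + basis_phase k).
Proof.
rewrite /trig_basis /basis_amp /basis_phase; case: eqVneq => [->|k0]/=.
  by rewrite /dot/= !mul0r !add0r cos0 mulr1.
by case: ifP => _; rewrite ?addr0// cosBpihalf.
Qed.

Definition basis_bound : R := (Num.sqrt vol)^-1 + Num.sqrt (2 / vol).

Lemma basis_bound_ge0 : 0 <= basis_bound.
Proof. by rewrite addr_ge0 ?invr_ge0 ?sqrtr_ge0. Qed.

Lemma basis_amp_le k : `|basis_amp k| <= basis_bound.
Proof.
rewrite /basis_amp /basis_bound; case: ifP => _.
  by rewrite ger0_norm ?invr_ge0 ?sqrtr_ge0// lerDl sqrtr_ge0.
by rewrite ger0_norm ?sqrtr_ge0// lerDr invr_ge0 sqrtr_ge0.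
Qed.

Lemma bounded_meas_basis k : bounded_meas basis_bound (trig_basis k).
Proof.
rewrite (_ : trig_basis k
  = fun x => basis_amp k * cos (dot k x + basis_phase k)).
  have [m b] := bounded_measZ (basis_amp k) (bounded_meas_wave k (basis_phase
    k)).
  by split => // x; apply: le_trans (b x) _; rewrite mulr1; exact: basis_amp_le.
by apply/funext => x; exact: trig_basisE.
Qed.

Lemma fourierD M M' f g k : bounded_meas M f -> bounded_meas M' g ->
  fourier (fun x => f x + g x) k = fourier f k + fourier g k.
Proof.
move=> bf bg; have bk := bounded_meas_basis k.
rewrite /fourier -RintegralD.
- by apply: eq_Rintegral => x _; rewrite mulrDl.
- exact: measurable_torus.
- exact: bounded_meas_integrable (bounded_measM bf bk).
- exact: bounded_meas_integrable (bounded_measM bg bk).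
Qed.

Lemma fourierZ M c f k : bounded_meas M f ->
  fourier (fun x => c * f x) k = c * fourier f k.
Proof.
move=> bf; have bk := bounded_meas_basis k.
rewrite /fourier -RintegralZl.
- by apply: eq_Rintegral => x _; rewrite mulrA.
- exact: measurable_torus.
- exact: bounded_meas_integrable (bounded_measM bf bk).
Qed.

Definition fourier_bound : R := basis_bound * vol.

Lemma fourier_bound_ge0 : 0 <= fourier_bound.
Proof. by rewrite mulr_ge0 ?basis_bound_ge0// ltW// vol_gt0. Qed.

Lemma fourier_le M f k : bounded_meas M f ->
  `|fourier f k| <= M * fourier_bound.
Proof.
move=> bf; have bk := bounded_meas_basis k; have bfk := bounded_measM bf bk.
have ifk := bounded_meas_integrable bfk.
rewrite /fourier; apply: le_trans (le_normr_Rintegral (@measurable_torus R)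
  ifk) _.
apply: (@le_trans _ _ (\int[@leb3 R]_(x in @torus R) (M * basis_bound))).
  apply: le_Rintegral.
  - exact: measurable_torus.
  - exact: integrable_norm ifk.
  - apply: (@bounded_meas_integrable (`|M * basis_bound|) (cst _)).
    by split => //; exact: measurable_cst.
  - by move=> x _; exact: bfk.2.
rewrite Rintegral_cst; last exact: measurable_torus.
by rewrite [X in fine X]leb3_torus/= -mulrA.
Qed.

Lemma dotD k l x : @dot R (k + l) x = dot k x + dot l x.
Proof. by rewrite /dot/= !intrD; ring. Qed.

Lemma dotN k x : @dot R (- k) x = - dot k x.
Proof. by rewrite /dot/= !intrN; ring. Qed.

(** The product of two waves is half the sum of waves of frequencies l + k and
    l - k, and a wave has mean zero unless its frequency vanishes. Hence only
    the coefficients at k = l and k = - l of a wave of frequency l can differ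
    from zero. *)
Lemma fourier_wave l (c : R) k :
  fourier (fun x => cos (dot l x + c)) k = basis_amp k * (vol / 2) *
   ((if l + k == 0 then cos (c + basis_phase k) else 0)
    + (if l == k then cos (c - basis_phase k) else 0)).
Proof.
have bw m d := bounded_meas_integrable (bounded_meas_wave m d).
transitivity (\int[@leb3 R]_(x in @torus R) (basis_amp k / 2 *
   (cos (dot (l + k) x + (c + basis_phase k)) +
    cos (dot (l - k) x + (c - basis_phase k))))).
  rewrite /fourier; apply: eq_Rintegral => x _; rewrite trig_basisE.
  set a := dot l x + c; set b := dot k x + basis_phase k.
  rewrite (_ : dot (l + k) x + _ = a + b); last by rewrite dotD /a /b; ring.
  rewrite (_ : dot (l - k) x + _ = a - b); last by rewrite dotD dotN /a /b;
    ring.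
  by rewrite cosD cosB; field.
have bD := bounded_measD (bounded_meas_wave (l + k) (c + basis_phase k))
  (bounded_meas_wave (l - k) (c - basis_phase k)).
have mT := @measurable_torus R.
rewrite (RintegralZl _ _ (bounded_meas_integrable bD))// RintegralD//.
rewrite !integral_cos_torus -![_ == (0, 0, 0)]/(_ == 0) subr_eq0.
by case: ifP => _; case: ifP => _; field.
Qed.

Lemma pos_halfN k : k != (0, 0, 0) -> pos_half (- k) = ~~ pos_half k.
Proof.
case: k => [[a b] c]; rewrite /pos_half !xpair_eqE/= !oppr_eq0 !oppr_gt0.
by case: (ltrgtP a 0); case: (ltrgtP b 0); case: (ltrgtP c 0).
Qed.

Lemma Z3_addrr_eq0 k : (k + k == 0) = (k == 0).
Proof.
case: k => [[a b] c]; rewrite -[_ == _]/((a + a, b + b, c + c) == (0, 0, 0)).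
rewrite -[RHS]/((a, b, c) == (0, 0, 0)) !xpair_eqE -!mulr2n !mulrn_eq0//.
Qed.

Lemma fourier_basis l k : fourier (@trig_basis R l) k = (l == k)%:R.
Proof.
have -> : @trig_basis R l
  = fun x => basis_amp l * cos (dot l x + basis_phase l).
  by apply/funext => x; exact: trig_basisE.
rewrite (fourierZ _ _ (bounded_meas_wave _ _)) fourier_wave.
have v0 : vol != 0 by rewrite gt_eqF// vol_gt0.
have sq1 : (Num.sqrt vol)^-1 * (Num.sqrt vol)^-1 * vol = 1.
  by rewrite -invfM -expr2 sqr_sqrtr ?mulVf// ltW// vol_gt0.
have sq2 : Num.sqrt (2 / vol) * Num.sqrt (2 / vol) * vol = 2.
  by rewrite -expr2 sqr_sqrtr ?divfK// divr_ge0// ltW// vol_gt0.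
have [<-{k}|lk] := eqVneq l k.
  rewrite Z3_addrr_eq0 subrr cos0 /basis_amp /basis_phase.
  rewrite -[l == 0]/(l == (0, 0, 0)).
  have [_|l0] := eqVneq l (0, 0, 0); first rewrite addr0 cos0.
    by rewrite -[RHS]sq1; move: (Num.sqrt vol)^-1 => s; field.
  rewrite add0r; apply: (mulfI (_ : 2 != 0 :> R)) => //.
  by rewrite [RHS]mulr1 -[RHS]sq2; move: (Num.sqrt _) => s; field.
rewrite addr0; case: ifPn => [|_]; last by rewrite !mulr0.
rewrite addr_eq0 => /eqP lE; rewrite [cos _](_ : _ = 0) ?mulr0//.
have l0 : l != (0, 0, 0).
  by apply: contra_neq lk => l0; move: lE; rewrite l0 => /eqP;
    rewrite eq_sym oppr_eq0 => /eqP ->.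
have k0 : k != (0, 0, 0).
  by apply: contra_neq lk => k0; rewrite lE k0 oppr0.
rewrite /basis_phase (negbTE l0) (negbTE k0) lE pos_halfN//=.
(* One of the two phases is 0, the other - pi/2. *)
by case: (pos_half k); rewrite /= ?addr0 ?add0r cosN cos_pihalf.
Qed.
End Fourier.

(** * Trigonometric polynomials *)

Section TrigPoly.
Variable R : realType.
Local Notation R1 := (measurableTypeR R).
Local Notation R3 := (R1 * R1 * R1)%type.
Implicit Types (k l : Z3).

Lemma jap_sq k : jap R k ^+ 2 =
  1 + (k.1.1%:~R ^+ 2 + k.1.2%:~R ^+ 2 + k.2%:~R ^+ 2).
Proof.
by rewrite /jap /freq_norm !sqr_sqrtr// ?addr_ge0// ?sqr_ge0// addr_ge0
  ?sqr_ge0.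
Qed.

Lemma jap_ge1 k : 1 <= jap R k.
Proof.
rewrite -(@ler_pXn2r _ 2) ?nnegrE// ?sqrtr_ge0// jap_sq expr1n lerDl.
by rewrite !addr_ge0 ?sqr_ge0.
Qed.

Lemma jap_gt0 k : 0 < jap R k.
Proof. exact: lt_le_trans (jap_ge1 k). Qed.

Lemma japN k : jap R (- k) = jap R k.
Proof.
by apply: (@pexpIrn _ 2) => //;
  rewrite ?nnegrE ?sqrtr_ge0// !jap_sq/= !intrN !sqrrN.
Qed.

Definition in_box (D : nat) k : bool :=
  [&& (absz k.1.1 <= D)%N, (absz k.1.2 <= D)%N & (absz k.2 <= D)%N].

Lemma in_boxD D D' k l : in_box D k -> in_box D' l -> in_box (D + D') (k + l).
Proof. by rewrite /in_box /=; lia. Qed.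

Lemma in_boxN D k : in_box D (- k) = in_box D k.
Proof. by rewrite /in_box /= !abszN. Qed.

Lemma in_boxW D D' k : (D <= D')%N -> in_box D k -> in_box D' k.
Proof. by rewrite /in_box; lia. Qed.

Lemma jap_sq_box D k : in_box D k -> jap R k ^+ 2 <= 1 + 3 * D%:R ^+ 2.
Proof.
have sq (z : int) : (absz z <= D)%N -> (z%:~R ^+ 2 : R) <= D%:R ^+ 2.
  move=> zD; rewrite -real_normK ?num_real//.
  have -> : `|z%:~R| = (absz z)%:R :> R by rewrite -intr_norm -abszE.
  by rewrite ler_pXn2r ?nnegrE// ler_nat.
by case/and3P => /sq h1 /sq h2 /sq h3; rewrite jap_sq; lra.
Qed.

Lemma jap_box D k : in_box D k -> jap R k <= 1 + 2 * D%:R.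
Proof.
move=> kD; rewrite -(@ler_pXn2r _ 2) ?nnegrE ?sqrtr_ge0 ?addr_ge0 ?mulr_ge0//.
apply: le_trans (jap_sq_box kD) _.
have := ler0n R D; have := sqr_ge0 (D%:R : R).
rewrite !expr2; nra.
Qed.

(** A wave (c, phi, l) stands for x |-> c cos(l.x + phi). As all phases are
    allowed, the product of two waves is a sum of two waves, without any
    distinction between sines and cosines. *)
Definition wave : Type := (R * R * Z3)%type.
Definition trigpoly : Type := seq wave.

Implicit Types (p q : trigpoly).

Definition trig_eval p (x : R3) : R := \sum_(w <- p) w.1.1 * cos (dot w.2 x +
  w.1.2).
(** An upper bound of the norm in the Wiener algebra. *)
Definition trig_norm p : R := \sum_(w <- p) `|w.1.1|.
Definition trig_supp (D : nat) p : bool := all (fun w : wave => in_box D w.2) p.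

Definition trig_scale (c : R) p : trigpoly := [seq (c * w.1.1, w.1.2,
  w.2) | w <- p].
(** The operator Delta - 1: a wave of frequency l is an eigenfunction, for the
    eigenvalue - <l>^2. *)
Definition trig_kg p : trigpoly :=
  [seq (- jap R w.2 ^+ 2 * w.1.1, w.1.2, w.2) | w <- p].
Definition trig_mul p q : trigpoly :=
  [seq (w.1.1 * v.1.1 / 2, w.1.2 + v.1.2, w.2 + v.2) | w <- p, v <- q] ++
  [seq (w.1.1 * v.1.1 / 2, w.1.2 - v.1.2, w.2 - v.2) | w <- p, v <- q].

Lemma trig_norm_ge0 p : 0 <= trig_norm p.
Proof. by apply: sumr_ge0 => w _. Qed.

Lemma bounded_meas_trig p : bounded_meas (trig_norm p) (trig_eval p).
Proof.
split; last first.
  move=> x; apply: le_trans (ler_norm_sum _ _ _) _; apply: ler_sum => w _.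
  by rewrite normrM ler_piMr// cos_max.
rewrite /trig_eval; apply: measurable_sum => w.
by apply: measurable_funM => //; exact: measurable_wave.
Qed.

Lemma trig_eval_cat p q x : trig_eval (p ++ q) x
  = trig_eval p x + trig_eval q x.
Proof. by rewrite /trig_eval big_cat. Qed.

Lemma trig_norm_cat p q : trig_norm (p ++ q) = trig_norm p + trig_norm q.
Proof. by rewrite /trig_norm big_cat. Qed.

Lemma trig_supp_cat D p q : trig_supp D (p ++ q)
  = trig_supp D p && trig_supp D q.
Proof. exact: all_cat. Qed.

Lemma tdegW D D' p : (D <= D')%N -> trig_supp D p -> trig_supp D' p.
Proof. by move=> DD'; apply: sub_all => w; exact: in_boxW. Qed.

Lemma trig_eval_scale c p x : trig_eval (trig_scale c p) x = c * trig_eval p x.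
Proof.
by rewrite /trig_eval big_map mulr_sumr; apply: eq_bigr => w _; rewrite mulrA.
Qed.

Lemma trig_norm_scale c p : trig_norm (trig_scale c p) = `|c| * trig_norm p.
Proof.
by rewrite /trig_norm big_map mulr_sumr; apply: eq_bigr => w _; rewrite normrM.
Qed.

Lemma trig_supp_scale D c p : trig_supp D (trig_scale c p) = trig_supp D p.
Proof. exact: all_map. Qed.

Lemma trig_eval_mul p q x : trig_eval (trig_mul p q) x
  = trig_eval p x * trig_eval q x.
Proof.
rewrite trig_eval_cat /trig_eval !big_allpairs_dep/= -big_split/= mulr_suml.
apply: eq_bigr => w _; rewrite -big_split/= mulr_sumr; apply: eq_bigr => v _.
set a := dot w.2 x + w.1.2; set b := dot v.2 x + v.1.2.
rewrite (_ : dot (w.2 + v.2) x + _ = a + b); last by rewrite dotD /a /b; ring.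
rewrite (_ : dot (w.2 - v.2) x + _ = a - b); last by rewrite dotD dotN /a /b;
  ring.
by rewrite cosD cosB; field.
Qed.

Lemma trig_norm_mul p q : trig_norm (trig_mul p q) = trig_norm p * trig_norm q.
Proof.
rewrite trig_norm_cat /trig_norm !big_allpairs_dep/= -big_split/= mulr_suml.
apply: eq_bigr => w _; rewrite -big_split/= mulr_sumr; apply: eq_bigr => v _.
by rewrite !normrM [`|2^-1|]ger0_norm//; field.
Qed.

Lemma trig_supp_mul D D' p q : trig_supp D p -> trig_supp D' q ->
  trig_supp (D + D') (trig_mul p q).
Proof.
move=> pD qD; rewrite trig_supp_cat; apply/andP; split;
  apply/allP => _ /allpairsP[[w v] /= [wp vq ->]] /=.
  by apply: in_boxD; [exact: (allP pD)|exact: (allP qD)].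
by apply: in_boxD; rewrite ?in_boxN; [exact: (allP pD)|exact: (allP qD)].
Qed.

Lemma trig_norm_kg D p : trig_supp D p ->
  trig_norm (trig_kg p) <= (1 + 3 * D%:R ^+ 2) * trig_norm p.
Proof.
move=> /allP pD; rewrite /trig_norm big_map mulr_sumr.
rewrite big_seq [leRHS]big_seq; apply: ler_sum => w wp /=.
by rewrite normrM ler_wpM2r// normrN ger0_norm ?sqr_ge0// jap_sq_box// pD.
Qed.

Lemma trig_supp_kg D p : trig_supp D (trig_kg p) = trig_supp D p.
Proof. exact: all_map. Qed.

Lemma fourier_trig p k : fourier (trig_eval p) k =
  \sum_(w <- p) w.1.1 * fourier (fun x => cos (dot w.2 x + w.1.2)) k.
Proof.
elim: p => [|w p IH].
  rewrite big_nil (_ : trig_eval [::] = fun x => 0 * cst 1 x); last first.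
    by apply/funext => x; rewrite mul0r /trig_eval big_nil.
  rewrite (fourierZ (M := 1))// ?mul0r//.
  by split; [exact: measurable_cst|move=> x; rewrite normr1].
rewrite big_cons -IH -(fourierZ _ _ (bounded_meas_wave _ _)).
rewrite -(fourierD _ (bounded_measZ _ (bounded_meas_wave _ _))
  (bounded_meas_trig p)).
by congr fourier; apply/funext => x; rewrite /trig_eval big_cons.
Qed.

Lemma fourier_wave0 l c k : k != l -> k != - l ->
  fourier (fun x => cos (@dot R l x + c)) k = 0.
Proof.
move=> kl kNl; rewrite fourier_wave [l == k]eq_sym (negbTE kl) [l + k]addrC
  addr_eq0.
by rewrite (negbTE kNl) addr0 mulr0.
Qed.

(** The waves that contribute to the coefficient at k have frequency k or - k,
    hence the same eigenvalue. *)
Lemma fourier_trig_kg p k : fourier (trig_eval (trig_kg p)) k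
  = - jap R k ^+ 2 * fourier (trig_eval p) k.
Proof.
rewrite !fourier_trig big_map mulr_sumr; apply: eq_bigr => w _ /=.
rewrite -mulrA; have [->|kl] := eqVneq k w.2; first by [].
have [->|kNl] := eqVneq k (- w.2); first by rewrite japN.
by rewrite fourier_wave0// !mulr0.
Qed.

Lemma sum_delta (F : seq Z3) (g : Z3 -> R) l : uniq F ->
  \sum_(k <- F) g k * (k == l)%:R = if l \in F then g l else 0.
Proof.
move=> uF; case: ifPn => lF; last first.
  rewrite big_seq big1// => k kF; rewrite (_ : k == l = false) ?mulr0//.
  by apply: contraNF lF => /eqP <-.
rewrite (big_rem l)//= eqxx mulr1 big_seq big1 ?addr0// => k.
by rewrite mem_rem_uniq// inE => /andP[/negbTE -> _]; rewrite mulr0.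
Qed.

Lemma sum_delta_le (F : seq Z3) (g : Z3 -> R) l : uniq F -> 0 <= g l ->
  \sum_(k <- F) g k * (k == l)%:R <= g l.
Proof. by move=> uF gl; rewrite sum_delta//; case: ifP. Qed.

(** A wave of frequency l contributes to the coefficients at l and - l only, and
    <l> = <- l>. *)
Lemma sum_fourier_trig D p (F : seq Z3) : uniq F -> trig_supp D p ->
  \sum_(k <- F) jap R k * `|fourier (trig_eval p) k| <=
  2 * fourier_bound R * (1 + 2 * D%:R) * trig_norm p.
Proof.
move=> uF pD.
apply: (@le_trans _ _ (\sum_(k <- F) \sum_(w <- p) `|w.1.1| * (fourier_bound R *
   (jap R k * (k == w.2)%:R + jap R k * (k == - w.2)%:R)))).
  apply: ler_sum => k _; rewrite fourier_trig.
  apply: le_trans (ler_wpM2l (ltW (jap_gt0 k)) (ler_norm_sum _ _ _)) _.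
  rewrite mulr_sumr; apply: ler_sum => w _; rewrite normrM mulrCA ler_wpM2l//.
  rewrite -mulrDr mulrCA ler_wpM2l ?(ltW (jap_gt0 k))//.
  have fb := fourier_bound_ge0 R.
  have := fourier_le k (bounded_meas_wave w.2 w.1.2); rewrite mul1r => fw.
  have [kl|kl] := eqVneq k w.2.
    by apply: le_trans fw _; rewrite ler_peMr// lerDl.
  have [kNl|kNl] := eqVneq k (- w.2); first by rewrite add0r mulr1.
  by rewrite fourier_wave0// normr0 addr0 mulr0.
rewrite exchange_big/= /trig_norm mulr_sumr big_seq [leRHS]big_seq.
apply: ler_sum => w wp; rewrite -mulr_sumr -mulr_sumr mulrC ler_wpM2r//.
rewrite -[leRHS]mulrA [leRHS]mulrCA ler_wpM2l ?fourier_bound_ge0// big_split/=.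
have jw := jap_box (allP pD w wp).
have j0 k := ltW (jap_gt0 k).
have h1 := @sum_delta_le F (jap R) w.2 uF (j0 _).
have h2 := @sum_delta_le F (jap R) (- w.2) uF (j0 _).
by rewrite japN in h2; lra.
Qed.

Definition trig_conv (f g : nat -> trigpoly) n : trigpoly :=
  flatten [seq trig_mul (f i) (g (n - i)%N) | i <- iota 0 n.+1].

Lemma trig_eval_flatten (s : seq trigpoly) x : trig_eval (flatten s) x
  = \sum_(p <- s) trig_eval p x.
Proof. by elim: s => [|p s IH];
  rewrite ?big_nil ?big_cons/= ?trig_eval_cat ?IH// /trig_eval big_nil. Qed.

Lemma trig_norm_flatten (s : seq trigpoly) : trig_norm (flatten s)
  = \sum_(p <- s) trig_norm p.
Proof. by elim: s => [|p s IH];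
  rewrite ?big_nil ?big_cons/= ?trig_norm_cat ?IH// /trig_norm big_nil. Qed.

Lemma trig_supp_flatten D (s : seq trigpoly) : trig_supp D (flatten s)
  = all (trig_supp D) s.
Proof. by elim: s => //= p s IH; rewrite trig_supp_cat IH. Qed.

Lemma trig_eval_conv f g n x :
  trig_eval (trig_conv f g n) x
    = cauchy_prod (fun i => trig_eval (f i) x) (fun i => trig_eval (g i) x) n.
Proof.
rewrite trig_eval_flatten big_map /cauchy_prod -[iota _ _]/(index_iota 0 n.+1)
  big_mkord.
by apply: eq_bigr => i _; rewrite trig_eval_mul.
Qed.

Lemma trig_norm_conv f g n :
  trig_norm (trig_conv f g n)
    = cauchy_prod (fun i => trig_norm (f i)) (fun i => trig_norm (g i)) n.
Proof.
rewrite trig_norm_flatten big_map /cauchy_prod -[iota _ _]/(index_iota 0 n.+1)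
  big_mkord.
by apply: eq_bigr => i _; rewrite trig_norm_mul.
Qed.

Lemma trig_supp_conv D f g n :
  (forall i, (i <= n)%N -> exists D1 D2,
     [/\ trig_supp D1 (f i), trig_supp D2 (g (n - i)%N) & (D1 + D2 <= D)%N]) ->
  trig_supp D (trig_conv f g n).
Proof.
move=> h; rewrite trig_supp_flatten all_map; apply/allP => i.
rewrite mem_iota add0n ltnS => /h[D1 [D2 [h1 h2 h3]]] /=.
exact: tdegW h3 (trig_supp_mul h1 h2).
Qed.

Lemma eq_trig_conv f f' g g' n : (forall i, (i <= n)%N -> f i = f' i) ->
  (forall i, (i <= n)%N -> g i = g' i) -> trig_conv f g n = trig_conv f' g' n.
Proof.
move=> ff' gg'; congr flatten; apply/eq_in_map => i.
by rewrite mem_iota add0n ltnS => iN; rewrite ff'// gg'// leq_subr.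
Qed.

Definition trig_cube u n : trigpoly := trig_conv u (trig_conv u u) n.

(** The recurrence between the Taylor coefficients in time of a solution. *)
Definition kg_step (u : nat -> trigpoly) n : trigpoly :=
  trig_scale ((n.+1%:R * n.+2%:R)^-1) (trig_kg (u n) ++ trig_scale (-1)
    (trig_cube u n)).

Lemma eq_kg_step u v n : (forall i, (i <= n)%N -> u i = v i) ->
  kg_step u n = kg_step v n.
Proof.
move=> uv; rewrite /kg_step /trig_cube uv//;
  congr (trig_scale _ (_ ++ trig_scale _ _)).
by apply: eq_trig_conv => // i iN; apply: eq_trig_conv => j ji; apply: uv;
  exact: leq_trans iN.
Qed.

Section Recursion.
Variables p0 p1 : trigpoly.

(** Each step uses all the previous coefficients, so the recursion builds the
    list of the coefficients of indices 0 to n + 1. *)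
Fixpoint kg_hist n : seq trigpoly :=
  if n is n'.+1 then rcons (kg_hist n') (kg_step (nth [::] (kg_hist n')) n')
  else [:: p0; p1].

Definition kg_coef n : trigpoly := nth [::] (kg_hist n) n.

Lemma size_kg_hist n : size (kg_hist n) = n.+2.
Proof. by elim: n => //= n IH; rewrite size_rcons IH. Qed.

Lemma nth_kg_hist n m i : (i < n.+2)%N ->
  nth [::] (kg_hist (n + m)) i = nth [::] (kg_hist n) i.
Proof.
move=> ni; elim: m => [|m IH]; first by rewrite addn0.
rewrite addnS/= nth_rcons size_kg_hist (leq_trans ni) ?IH//.
by rewrite !ltnS leq_addr.
Qed.

Lemma kg_coef0 : kg_coef 0 = p0. Proof. by []. Qed.

Lemma kg_coef1 : kg_coef 1 = p1. Proof. by []. Qed.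

Lemma kg_histE n i : (i < n.+2)%N -> nth [::] (kg_hist n) i = kg_coef i.
Proof.
move=> ni; rewrite /kg_coef; have [iN|nI] := leqP i n.
  by rewrite -{1}(subnKC iN) nth_kg_hist.
have -> : i = (n + 1)%N by lia.
by rewrite nth_kg_hist// addn1.
Qed.

Lemma kg_coefSS n : kg_coef n.+2 = kg_step kg_coef n.
Proof.
rewrite -(@kg_histE n.+1)//= nth_rcons size_kg_hist ltnn eqxx.
by apply: eq_kg_step => i iN; rewrite kg_histE// ltnW.
Qed.

Variables (N : nat) (M rho : R).
Hypothesis rho0 : 0 <= rho.
Hypothesis M0 : 0 <= M.
Hypothesis rhoM : 1 + 3 * N%:R ^+ 2 + M ^+ 2 <= rho ^+ 2.
Hypothesis p0N : trig_supp N p0.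
Hypothesis p1N : trig_supp N p1.
Hypothesis p0M : trig_norm p0 <= M.
Hypothesis p1M : trig_norm p1 <= M * rho.

(** As the frequencies of the n-th coefficient are at most (n + 1) N, the operator
    Delta - 1 costs a factor at most (n + 1)^2 (1 + 3 N^2). The cubic term is
    a sum of at most (n + 1)^2 products, each of norm at most M^3 rho^n. The
    denominator (n + 1) (n + 2) compensates both, and the remaining factor
    1 + 3 N^2 + M^2 is at most rho^2. *)
Lemma kg_coef_bounds n :
  trig_supp (n.+1 * N) (kg_coef n) && (trig_norm (kg_coef n) <= M * rho ^+ n).
Proof.
elim/ltn_ind: n => -[|[|n]] IH.
- by rewrite kg_coef0 expr0 mulr1 mul1n p0N.
- by rewrite kg_coef1 expr1 p1M andbT (tdegW _ p1N)// leq_pmull.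
have deg i : (i <= n)%N -> trig_supp (i.+1 * N) (kg_coef i).
  by move=> iN; have /andP[] := IH i (leqW iN).
have nrm i : (i <= n)%N -> trig_norm (kg_coef i) <= M * rho ^+ i.
  by move=> iN; have /andP[] := IH i (leqW iN).
have conv2 i : (i <= n)%N ->
  trig_supp (i.+2 * N) (trig_conv kg_coef kg_coef i) &&
    (trig_norm (trig_conv kg_coef kg_coef i) <= n.+1%:R * (M ^+ 2 * rho ^+ i)).
  move=> iN; apply/andP; split.
    apply: trig_supp_conv => j ji; exists (j.+1 * N)%N, ((i - j).+1 * N)%N;
      split.
    - by apply: deg; lia.
    - by apply: deg; lia.
    - nia.
  rewrite trig_norm_conv /cauchy_prod.
  apply: (@le_trans _ _ (\sum_(j < i.+1) M ^+ 2 * rho ^+ i)).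
    apply: ler_sum => j _; have ji : (j <= i)%N by rewrite -ltnS.
    have -> : M ^+ 2 * rho ^+ i = (M * rho ^+ j) * (M * rho ^+ (i - j)).
      by rewrite mulrACA -exprD subnKC.
    by apply: ler_pM; rewrite ?trig_norm_ge0//; apply: nrm; lia.
  rewrite sumr_const card_ord -[leLHS]mulr_natl ler_wpM2r ?ler_nat//.
  by rewrite mulr_ge0 ?exprn_ge0.
rewrite kg_coefSS /kg_step; apply/andP; split.
  rewrite trig_supp_scale trig_supp_cat trig_supp_kg trig_supp_scale;
    apply/andP; split.
    by apply: tdegW (deg n (leqnn n)); nia.
  apply: trig_supp_conv => j jn; exists (j.+1 * N)%N, ((n - j).+2 * N)%N; split.
  - exact: deg.
  - by have /andP[] := conv2 (n - j)%N (leq_subr _ _).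
  - nia.
have cube : trig_norm (trig_cube kg_coef n)
  <= n.+1%:R ^+ 2 * (M ^+ 3 * rho ^+ n).
  rewrite trig_norm_conv /cauchy_prod.
  apply: (@le_trans _ _ (\sum_(j < n.+1) n.+1%:R * (M ^+ 3 * rho ^+ n))).
    apply: ler_sum => j _; have ji : (j <= n)%N by rewrite -ltnS.
    have -> : n.+1%:R * (M ^+ 3 * rho ^+ n) =
        (M * rho ^+ j) * (n.+1%:R * (M ^+ 2 * rho ^+ (n - j))).
      have -> : rho ^+ n = rho ^+ j * rho ^+ (n - j) by rewrite -exprD subnKC.
      ring.
    apply: ler_pM; rewrite ?trig_norm_ge0//; first exact: nrm.
    by have /andP[] := conv2 (n - j)%N (leq_subr _ _).
  by rewrite sumr_const card_ord -[leLHS]mulr_natl mulrA expr2.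
rewrite trig_norm_scale trig_norm_cat trig_norm_scale normrN1 mul1r.
have kg := trig_norm_kg (deg n (leqnn n)).
rewrite ger0_norm ?invr_ge0 ?mulr_ge0// ler_pdivrMl ?mulr_gt0//.
have nn := nrm n (leqnn n).
set r := rho ^+ n in nn cube *; have r0 : 0 <= r by rewrite exprn_ge0.
have -> : M * rho ^+ n.+2 = M * r * rho ^+ 2 by rewrite -addn2 exprD -/r; ring.
set a := (n.+1%:R : R); have a1 : 1 <= a by rewrite ler1n.
have -> : (n.+2%:R : R) = a + 1 by rewrite -natr1.
apply: (@le_trans _ _ (a ^+ 2 * ((1 + 3 * N%:R ^+ 2 + M ^+ 2) * (M * r)))).
  have h1 : trig_norm (trig_kg (kg_coef n))
    <= a ^+ 2 * ((1 + 3 * N%:R ^+ 2) * (M * r)).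
    apply: le_trans kg _; rewrite mulrA; apply: ler_pM => //.
    - exact: trig_norm_ge0.
    - rewrite natrM -/a exprMn mulrDr mulr1 mulrCA lerD2r.
      by rewrite expr2 -[leLHS]mul1r ler_pM.
  apply: le_trans (lerD h1 cube) _.
  by rewrite le_eqVlt; apply/orP; left; apply/eqP; ring.
have Mr : 0 <= M * r by rewrite mulr_ge0.
rewrite [M * r * _]mulrC; apply: ler_pM.
- exact: sqr_ge0.
- by rewrite mulr_ge0// !addr_ge0 ?mulr_ge0 ?sqr_ge0.
- by rewrite expr2 ler_wpM2l ?lerDl// (le_trans _ a1).
- exact: ler_wpM2r.
Qed.

End Recursion.
End TrigPoly.

(** * The norm of the phase space *)

Section PhaseNorm.
Variable R : realType.

Lemma esum_le_seq (f : Z3 -> R) (C : R) :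
  (forall F : seq Z3, uniq F -> \sum_(k <- F) f k <= C) ->
  (\esum_(k in [set: Z3]) (f k)%:E <= C%:E)%E.
Proof.
move=> h; apply: ge_ereal_sup => _ [A [finA _] <-].
rewrite fsbig_finite// sumEFin lee_fin; apply: h; exact: finmap.fset_uniq.
Qed.

Lemma sum_sq_le (g : Z3 -> R) (F : seq Z3) : (forall k, 0 <= g k) ->
  \sum_(k <- F) g k ^+ 2 <= (\sum_(k <- F) g k) ^+ 2.
Proof.
move=> g0; elim: F => [|k F IH]; first by rewrite !big_nil expr0n.
rewrite !big_cons sqrrD -addrA lerD2l (le_trans IH)// lerDr mulrn_wge0//.
by rewrite mulr_ge0// sumr_ge0.
Qed.

(** For s <= 1/2 the H^s norm is controlled by a weighted l^1 norm, since sums of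
    squares are at most squares of sums. The l^1 norm is additive over the
    terms of a series, which spares an infinite triangle inequality in H^s. *)
Lemma sobolev_sq_le (s : R) (a g : distr R) (Gam L : R) :
  2 * s <= 1 -> 0 <= Gam -> 0 <= L ->
  (forall k, 0 <= g k) -> (forall k, `|a k| <= L * g k) ->
  (forall F : seq Z3, uniq F -> \sum_(k <- F) jap R k * g k <= Gam) ->
  (sobolev_sq s a <= ((L * Gam) ^+ 2)%:E)%E.
Proof.
move=> s1 Gam0 L0 g0 ag Fg; apply: esum_le_seq => F uF.
apply: (@le_trans _ _ ((L * \sum_(k <- F) jap R k * g k) ^+ 2)); last first.
  have S0 : 0 <= \sum_(k <- F) jap R k * g k.
    by apply: sumr_ge0 => k _; rewrite mulr_ge0// ltW// jap_gt0.
  by rewrite ler_pXn2r ?nnegrE ?mulr_ge0// ler_wpM2l// Fg.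
rewrite mulr_sumr; apply: le_trans (sum_sq_le _ _); last first.
  by move=> k; rewrite !mulr_ge0// ltW// jap_gt0.
apply: ler_sum => k _; have j1 := jap_ge1 R k.
have -> : (L * (jap R k * g k)) ^+ 2 = jap R k ^+ 2 * (L * g k) ^+ 2 by ring.
apply: ler_pM; rewrite ?powR_ge0 ?sqr_ge0//.
  apply: (@le_trans _ _ (jap R k));
    last by rewrite expr2 ler_peMl// (le_trans _ j1).
  by rewrite -[leRHS]powRr1 ?(le_trans _ j1)// ler_powR.
by rewrite -real_normK ?num_real// ler_pXn2r ?nnegrE ?mulr_ge0.
Qed.

Lemma sobolev_sq_ge0 s (a : distr R) : (0 <= sobolev_sq s a)%E.
Proof. by apply: esum_ge0 => k _;
  rewrite lee_fin mulr_ge0 ?powR_ge0 ?sqr_ge0. Qed.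

Lemma phase_norm_leP (v : phase R) (C : R) : 0 <= C ->
  (phase_norm 2^-1 v <= C%:E)%E <->
  (sobolev_sq 2^-1 v.1 + sobolev_sq (2^-1 - 1) v.2 <= (C ^+ 2)%:E)%E.
Proof.
move=> C0; rewrite /phase_norm.
set S := (_ + _)%E; have S0 : (0 <= S)%E by rewrite adde_ge0// sobolev_sq_ge0.
have inI (x : \bar R) : (0 <= x)%E -> x \in `[0%E, +oo%E].
  by rewrite in_itv/= leey andbT.
split=> h.
  have : ((S `^ 2^-1) `^ 2 <= C%:E `^ 2)%E.
    by apply: gt0_ler_poweR h; rewrite ?inI// ?poweR_ge0.
  by rewrite poweR_EFin powR_mulrn// -poweRrM mulVf// poweRe1.
have : (S `^ 2^-1 <= (C ^+ 2)%:E `^ 2^-1)%E.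
  by apply: gt0_ler_poweR h; rewrite ?inI ?lee_fin ?sqr_ge0 ?invr_ge0.
by rewrite poweR_EFin powR12_sqrt ?sqr_ge0// sqrtr_sqr ger0_norm.
Qed.

Lemma phase_norm_le (v : phase R) (g : distr R) (Gam L : R) :
  0 <= Gam -> 0 <= L -> (forall k, 0 <= g k) ->
  (forall k, `|v.1 k| <= L * g k) -> (forall k, `|v.2 k| <= L * g k) ->
  (forall F : seq Z3, uniq F -> \sum_(k <- F) jap R k * g k <= Gam) ->
  (phase_norm 2^-1 v <= (2 * (L * Gam))%:E)%E.
Proof.
move=> Gam0 L0 g0 v1 v2 Fg; apply/phase_norm_leP; first by rewrite !mulr_ge0.
have s1 : (sobolev_sq 2^-1 v.1 <= ((L * Gam) ^+ 2)%:E)%E.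
  by apply: sobolev_sq_le Fg => //; rewrite mulfV.
have s2 : (sobolev_sq (2^-1 - 1) v.2 <= ((L * Gam) ^+ 2)%:E)%E.
  by apply: sobolev_sq_le Fg => //; lra.
apply: (le_trans (leeD s1 s2)); rewrite -EFinD lee_fin.
by have := sqr_ge0 (L * Gam); rewrite [in X in _ -> X]exprMn; lra.
Qed.

Lemma sobolev_sq_coef s (a : distr R) k :
  ((jap R k `^ (2 * s) * a k ^+ 2)%:E <= sobolev_sq s a)%E.
Proof.
apply: ereal_sup_ubound; exists [set k]; first by split=> //;
  exact: finite_set1.
by rewrite fsbig_set1.
Qed.

(** Both weights <k> and 1 / <k> are bounded below by 1 / <k>^2, which gives one
    bound for both components. *)
Lemma phase_norm_coef (v : phase R) (C : R) k : 0 <= C ->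
  (phase_norm 2^-1 v <= C%:E)%E ->
  `|v.1 k| <= jap R k * C /\ `|v.2 k| <= jap R k * C.
Proof.
move=> C0 /(phase_norm_leP _ C0) tot.
have j1 := jap_ge1 R k; have j0 := jap_gt0 R k.
have := le_trans (leeD (sobolev_sq_coef 2^-1 v.1 k) (sobolev_sq_coef (2^-1 -
  1) v.2 k)) tot.
rewrite -EFinD lee_fin mulfV// powRr1 ?(ltW j0)//.
have -> : 2 * (2^-1 - 1) = -1 :> R by field.
rewrite powRN powRr1 ?(ltW j0)// => h.
have h1 : 0 <= jap R k * v.1 k ^+ 2 by rewrite mulr_ge0 ?sqr_ge0// ltW.
have h2 : 0 <= (jap R k)^-1 * v.2 k ^+ 2 by rewrite mulr_ge0 ?sqr_ge0//
  invr_ge0 ltW.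
split; rewrite -(@ler_pXn2r _ 2) ?nnegrE ?mulr_ge0 ?(ltW j0)// real_normK
  ?num_real// exprMn.
  apply: (@le_trans _ _ (jap R k * v.1 k ^+ 2));
    first by rewrite ler_peMl ?sqr_ge0.
  apply: (@le_trans _ _ (C ^+ 2)); first lra.
  by rewrite ler_peMl ?sqr_ge0// expr2 -[leLHS]mul1r ler_pM.
apply: (@le_trans _ _ (jap R k * C ^+ 2)).
  by rewrite -ler_pdivrMl//; lra.
by rewrite ler_wpM2r ?sqr_ge0// expr2 ler_peMl// ltW.
Qed.

Lemma sum_le_esum (f : Z3 -> R) (F : seq Z3) : uniq F ->
  ((\sum_(k <- F) f k)%:E <= \esum_(k in [set: Z3]) (f k)%:E)%E.
Proof.
move=> uF; apply: ereal_sup_ubound; exists [set` F]; first by split=> //;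
  exact: finite_seq.
by rewrite -fsbig_seq// sumEFin.
Qed.

Lemma sobolev_sqD_le s (a b : distr R) (A B : R) :
  (sobolev_sq s a <= A%:E)%E -> (sobolev_sq s b <= B%:E)%E ->
  (sobolev_sq s (fun k => (a k + b k)%R) <= (2 * A + 2 * B)%:E)%E.
Proof.
move=> hA hB; apply: esum_le_seq => F uF.
have := le_trans (sum_le_esum _ uF) hA; rewrite lee_fin => {}hA.
have := le_trans (sum_le_esum _ uF) hB; rewrite lee_fin => {}hB.
apply: le_trans (lerD (ler_wpM2l (ler0n R 2) hA) (ler_wpM2l (ler0n R 2) hB)).
rewrite !mulr_sumr -big_split/=; apply: ler_sum => k _.
set j := _ `^ _; have -> : 2 * (j * a k ^+ 2) + 2 * (j * b k ^+ 2) =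
  j * (2 * a k ^+ 2 + 2 * b k ^+ 2) by ring.
rewrite ler_wpM2l ?powR_ge0//.
rewrite -subr_ge0 (_ : _ - _ = (a k - b k) ^+ 2) ?sqr_ge0//; ring.
Qed.

End PhaseNorm.

(** * Solutions with trigonometric data *)

Section SeriesOfFunctions.
Variable R : realType.
Local Notation R1 := (measurableTypeR R).
Local Notation R3 := (R1 * R1 * R1)%type.
Variables (f : nat -> R3 -> R) (B r t : R).
Hypothesis r0 : 0 <= r.
Hypothesis tr : `|t| * r <= 2^-1.
Hypothesis bf : forall n, bounded_meas (B * r ^+ n) (f n).

Let geof x : geo B r (f ^~ x).
Proof. by move=> n; exact: (bf n).2. Qed.

Lemma geo_fourier k : geo (B * fourier_bound R) r (fun n => fourier (f n) k).
Proof.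
by move=> n; apply: le_trans (fourier_le k (bf n)) _; rewrite mulrAC.
Qed.

Lemma measurable_psum : measurable_fun setT (fun x => psum (f ^~ x) t).
Proof.
apply: (@measurable_fun_cvg _ _ _ setT (fun m x => pseries (f ^~ x) t m)).
  move=> m; rewrite /pseries /series/=; apply: measurable_sum => n.
  by apply: measurable_funM => //; exact: (bf n).1.
by move=> x _; exact: geo_cvg (geof x).
Qed.

Lemma bounded_meas_psum : bounded_meas (2 * B) (fun x => psum (f ^~ x) t).
Proof. by split; [exact: measurable_psum|move=> x; exact: geo_le (geof x)]. Qed.

(** The partial sums converge uniformly in x, and a Fourier coefficient is
    bounded by the supremum of the function. *)
Lemma fourier_psum k :
  fourier (fun x => psum (f ^~ x) t) k = psum (fun n => fourier (f n) k) t.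
Proof.
pose S m x := pseries (f ^~ x) t m.
have bS m : bounded_meas (2 * B) (S m).
  split; first by rewrite /S /pseries /series/=; apply: measurable_sum => n;
    apply: measurable_funM => //; exact: (bf n).1.
  move=> x; rewrite /S /pseries /series/=;
    apply: le_trans (ler_norm_sum _ _ _) _.
  by have := geo_block 0 m r0 tr (geof x); rewrite expr0 mulr1.
have fS m : fourier (S m) k = pseries (fun n => fourier (f n) k) t m.
  elim: m => [|m IH].
    rewrite (_ : S 0 = fun x => 0 * f 0%N x); last first.
      by apply/funext => x; rewrite /S /pseries /series/= big_geq// mul0r.
    by rewrite (fourierZ _ _ (bf 0)) mul0r /pseries /series/= big_geq.
  rewrite (_ : S m.+1 = fun x => S m x + t ^+ m * f m x); last first.
    by apply/funext => x;
      rewrite /S /pseries /series/= big_nat_recr//= [t ^+ m * _]mulrC.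
  rewrite (fourierD _ (bS m) (bounded_measZ _ (bf m))) IH (fourierZ _ _ (bf m)).
  by rewrite /pseries /series/= big_nat_recr//= [t ^+ m * _]mulrC.
have cv : pseries (fun n => fourier (f n) k) t @ \oo -->
    fourier (fun x => psum (f ^~ x) t) k.
  have h : geometric (2 * B * fourier_bound R) 2^-1 m @[m --> \oo] --> (0 : R).
    by apply: cvg_geometric; rewrite ger0_norm// invf_lt1// ltr1n.
  apply/subr_cvg0.
  apply: (@squeeze_cvgr _ _ _ _ (fun n => - geometric (2 * B * fourier_bound
    R) 2^-1 n)
    (geometric (2 * B * fourier_bound R) 2^-1)); last 2 first.
  - by rewrite -oppr0; exact: cvgN.
  - exact: h.
  near=> m; rewrite -ler_norml -fS.
  have bD : bounded_meas (2 * B * 2^-1 ^+ m)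
      (fun x => S m x + -1 * psum (f ^~ x) t).
    split; first exact: (bounded_measD (bS m) (bounded_measZ (-1)
      bounded_meas_psum)).1.
    by move=> x; rewrite mulN1r distrC; exact: geo_rem (geof x).
  have := fourier_le k bD.
  rewrite (fourierD _ (bS m) (bounded_measZ _ bounded_meas_psum)).
  by rewrite (fourierZ _ _ bounded_meas_psum) mulN1r/= mulrAC.
by apply/esym/cvg_lim.
Unshelve. all: by end_near. Qed.

End SeriesOfFunctions.

Section LocalSolution.
Variable R : realType.
Local Notation R1 := (measurableTypeR R).
Local Notation R3 := (R1 * R1 * R1)%type.
Variables (p0 p1 : trigpoly R) (N : nat) (M rho : R).
Hypothesis rho0 : 0 < rho.
Hypothesis M0 : 0 <= M.
Hypothesis rhoM : 1 + 3 * N%:R ^+ 2 + M ^+ 2 <= rho ^+ 2.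
Hypothesis p0N : trig_supp N p0.
Hypothesis p1N : trig_supp N p1.
Hypothesis p0M : trig_norm p0 <= M.
Hypothesis p1M : trig_norm p1 <= M * rho.

Local Notation U := (kg_coef p0 p1).

(** The largest ratio met below is 4 rho, for the Taylor coefficients of u^3, and
    the continuity of that series needs a further factor 8. For |t| < 2 T this
    leaves 32 rho |t| < 1/2. *)
Definition kg_time : R := (128 * rho)^-1.
Definition kg_sol (t : R) (x : R3) : R := psum (fun n => trig_eval (U n) x) t.
Definition kg_fcoef (k : Z3) (n : nat) : R := fourier (trig_eval (U n)) k.
Definition kg_dsol (t : R) : distr R := fun k => psum (pseries_diffs (kg_fcoef
  k)) t.
Definition kg_cubecoef (k : Z3) (n : nat) : R := fourier (trig_eval (trig_cube
  U n)) k.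

Local Notation T := kg_time.
Local Notation u := kg_sol.
Local Notation c := kg_fcoef.
Local Notation ut := kg_dsol.
Local Notation d := kg_cubecoef.

Lemma rho_ge0 : 0 <= rho. Proof. exact: ltW. Qed.

Lemma kg_coef_le n :
  trig_supp (n.+1 * N) (U n) && (trig_norm (U n) <= M * rho ^+ n).
Proof. exact: (kg_coef_bounds rho_ge0 M0 rhoM p0N p1N p0M p1M). Qed.

Lemma kg_time_gt0 : 0 < T. Proof. by rewrite /kg_time invr_gt0 mulr_gt0. Qed.

Lemma kg_timeM : T * rho = 128^-1.
Proof. by rewrite /kg_time; field; rewrite gt_eqF. Qed.

Lemma radius_le_frac (t q : R) : `|t| < 2 * T -> 0 <= q ->
  `|t| * (q * rho) <= q / 64.
Proof.
move=> tT q0; rewrite mulrCA ler_wpM2l//.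
have -> : 64^-1 = 2 * T * rho by rewrite -mulrA kg_timeM; field.
by rewrite ler_wpM2r// ltW.
Qed.

Lemma bounded_meas_coef n : bounded_meas (M * rho ^+ n) (trig_eval (U n)).
Proof.
have [m b] := bounded_meas_trig (U n); split => // x.
by apply: le_trans (b x) _; have /andP[] := kg_coef_le n.
Qed.

Lemma geo_coef x : geo M rho (fun n => trig_eval (U n) x).
Proof. by move=> n; exact: (bounded_meas_coef n).2. Qed.

Lemma geo_trig_norm : geo M rho (fun n => trig_norm (U n)).
Proof. by move=> n; rewrite ger0_norm ?trig_norm_ge0//;
  have /andP[] := kg_coef_le n. Qed.

Lemma rho_le2 : 0 <= rho <= 2 * rho. Proof. rewrite rho_ge0/=;
  have := rho_ge0; lra. Qed.

Lemma bounded_meas_cube n : bounded_meas (M * (M * M) * (4 * rho) ^+ n)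
  (trig_eval (trig_cube U n)).
Proof.
have [m b] := bounded_meas_trig (trig_cube U n); split => // x.
apply: le_trans (b x) _.
have r2 : 0 <= 2 * rho by rewrite mulr_ge0 ?rho_ge0.
have g := geo_conv r2 (geoW rho_le2 geo_trig_norm) (geo_conv rho_ge0
  geo_trig_norm geo_trig_norm).
rewrite -[leLHS]ger0_norm ?trig_norm_ge0// trig_norm_conv.
have -> : (fun i => trig_norm (trig_conv U U i)) =
    cauchy_prod (fun i => trig_norm (U i)) (fun i => trig_norm (U i)).
  by apply/funext => i; rewrite trig_norm_conv.
have -> : 4 * rho = 2 * (2 * rho) by ring.
exact: g.
Qed.

Lemma kg_sol_cube (t : R) x : `|t| < 2 * T ->
  u t x ^+ 3 = psum (fun n => trig_eval (trig_cube U n) x) t.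
Proof.
move=> tT; have r2 : 0 <= 2 * rho by rewrite mulr_ge0 ?rho_ge0.
have -> : (fun n => trig_eval (trig_cube U n) x)
  = cauchy_prod (fun n => trig_eval (U n) x)
    (cauchy_prod (fun n => trig_eval (U n) x) (fun n => trig_eval (U n) x)).
  apply/funext => n; rewrite trig_eval_conv; congr (cauchy_prod _ _ n).
  by apply/funext => i; rewrite trig_eval_conv.
rewrite (psum_conv r2 _ (geoW rho_le2 (geo_coef x)) (geo_conv rho_ge0
  (geo_coef x) (geo_coef x))).
  rewrite (psum_conv rho_ge0 _ (geo_coef x) (geo_coef x)) ?exprS ?expr0
    ?mulr1//.
  by have := radius_le_frac tT (ler0n R 2); lra.
by have := radius_le_frac tT (ler0n R 4); lra.
Qed.

Lemma radius_one (t : R) : `|t| < 2 * T -> `|t| * rho <= 2^-1.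
Proof. by move=> tT; have := radius_le_frac tT ler01; rewrite mul1r; lra. Qed.

Lemma radius_four (t : R) : `|t| < 2 * T -> `|t| * (4 * rho) <= 2^-1.
Proof. by move=> tT; have := radius_le_frac tT (ler0n R 4); lra. Qed.

Lemma fourier_kg_sol (t : R) k : `|t| < 2 * T -> fourier (u t) k = psum (c k) t.
Proof. by move=> tT; rewrite /u (fourier_psum rho_ge0 _ bounded_meas_coef)//
  radius_one. Qed.

Lemma fourier_kg_cube (t : R) k : `|t| < 2 * T ->
  fourier (fun x => u t x ^+ 3) k = psum (d k) t.
Proof.
move=> tT; have -> : (fun x => u t x ^+ 3)
  = fun x => psum (fun n => trig_eval (trig_cube U n) x) t.
  by apply/funext => x; exact: kg_sol_cube.
by rewrite (fourier_psum _ _ bounded_meas_cube) ?radius_four// mulr_ge0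
  ?rho_ge0.
Qed.

Lemma geo_fcoef k : geo (M * fourier_bound R) rho (c k).
Proof. exact: geo_fourier bounded_meas_coef k. Qed.

Lemma geo_cubecoef k : geo (M * (M * M) * fourier_bound R) (4 * rho) (d k).
Proof. exact: geo_fourier bounded_meas_cube k. Qed.

Lemma is_derive_fcoef (t : R) k : `|t| < 2 * T ->
  is_derive t 1 (psum (c k)) (ut t k).
Proof.
move=> tT; apply: geo_derive (geo_fcoef k) => //.
by have := radius_le_frac tT (ler0n R 8); lra.
Qed.

(** The recurrence on the Taylor coefficients, read at frequency k: it is the
    equation a'' = - <k>^2 a - (u^3)^(k) between power series. *)
Lemma kg_fcoef_rec k n : n.+1%:R * (n.+2%:R * c k n.+2) =
  - (jap R k) ^+ 2 * c k n + - d k n.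
Proof.
rewrite {1}/kg_fcoef kg_coefSS.
have bK := bounded_meas_trig (trig_kg (U n));
  have bC := bounded_meas_trig (trig_cube U n).
rewrite (_ : trig_eval _ = fun x => (n.+1%:R * n.+2%:R)^-1 *
    (trig_eval (trig_kg (U n)) x + -1 * trig_eval (trig_cube U n) x));
      last first.
  by apply/funext => x; rewrite trig_eval_scale trig_eval_cat trig_eval_scale.
rewrite (fourierZ _ _ (bounded_measD bK (bounded_measZ (-1) bC))).
rewrite (fourierD _ bK (bounded_measZ (-1) bC)) (fourierZ _ _ bC)
  fourier_trig_kg.
rewrite mulN1r -/(c k n) -/(d k n) mulrA mulrA mulfV ?mul1r//.
Qed.

Lemma is_derive_kg_dsol (t : R) k : `|t| < 2 * T ->
  is_derive t 1 (fun s => ut s k) (- (jap R k ^+ 2 * psum (c k) t) - psum (d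
    k) t).
Proof.
move=> tT; have h1 := geo_diffs rho_ge0 (geo_fcoef k).
have r2 : 0 < 2 * rho by rewrite mulr_gt0.
have t16 : `|t| * (8 * (2 * rho)) < 1.
  by have := radius_le_frac tT (ler0n R 16); lra.
have := geo_derive r2 t16 h1; move/is_derive_eq; apply.
have -> : pseries_diffs (pseries_diffs (c k)) =
    fun n => - (jap R k) ^+ 2 * c k n + -1 * d k n.
  by apply/funext => n; rewrite mulN1r -kg_fcoef_rec.
have r4 : 0 <= 4 * rho by rewrite mulr_ge0 ?rho_ge0.
have gc : geo (M * fourier_bound R) (4 * rho) (c k).
  by apply: geoW (geo_fcoef k); rewrite rho_ge0/=; have := rho_ge0; lra.
rewrite (psumD r4 (radius_four tT) (geoZ _ gc) (geoZ _ (geo_cubecoef k))).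
rewrite (psumZ _ r4 (radius_four tT) gc) (psumZ _ r4 (radius_four tT)
  (geo_cubecoef k)).
by rewrite mulNr mulN1r.
Qed.

Lemma continuous_cubecoef (t : R) k : `|t| < 2 * T ->
  {for t, continuous (psum (d k))}.
Proof.
move=> tT; have r4 : 0 < 4 * rho by rewrite mulr_gt0.
apply: is_derive_continuous; apply: (geo_derive r4 _ (geo_cubecoef k)).
by have := radius_le_frac tT (ler0n R 32); lra.
Qed.

(** The majorant, at frequency k, of the coefficients of the solution and of its
    time derivative, and of their difference quotients. *)
Definition kg_weight (k : Z3) : R := psum (fun n => `|c k n|) (4 * T).
Definition kg_bound : R := 2 * (2 * fourier_bound R * (1 + 2 * N%:R) * M).

Lemma kg_bound_ge0 : 0 <= kg_bound.
Proof.
have f0 := fourier_bound_ge0 R; have N0 : 0 <= (N%:R : R) by [].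
rewrite /kg_bound; move: (fourier_bound R) f0 => f f0.
by apply: mulr_ge0 => //; apply: mulr_ge0 => //; apply: mulr_ge0; [lra|lra].
Qed.

Lemma radius_dom q : `|4 * T| * (q * rho) = q / 32.
Proof.
rewrite ger0_norm ?mulr_ge0 ?(ltW kg_time_gt0)//.
have -> : 4 * T * (q * rho) = 4 * q * (T * rho) by ring.
by rewrite kg_timeM; field.
Qed.

(** At order n in time, the sum over k is at most a constant times
    (n + 1) (1 + 2 N) M rho^n, and doubling rho absorbs n + 1. *)
Lemma kg_weight_sum (F : seq Z3) : uniq F ->
  \sum_(k <- F) jap R k * kg_weight k <= kg_bound.
Proof.
move=> uF; pose S n := \sum_(k <- F) jap R k * `|c k n|.
have r2 : 0 <= 2 * rho by rewrite mulr_ge0 ?rho_ge0.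
have gS : geo (2 * fourier_bound R * (1 + 2 * N%:R) * M) (2 * rho) S.
  move=> n; rewrite ger0_norm; last first.
    by apply: sumr_ge0 => k _; rewrite mulr_ge0// ltW// jap_gt0.
  have /andP[dU nU] := kg_coef_le n.
  apply: le_trans (sum_fourier_trig uF dU) _.
  have f0 := fourier_bound_ge0 R.
  have N0 : 0 <= (N%:R : R) by [].
  have n1 := nat_le_exp2 R n.
  move: (fourier_bound R) f0 => f f0.
  have -> : 2 * f * (1 + 2 * N%:R) * M * (2 * rho) ^+ n =
    2 * f * (2 ^+ n * (1 + 2 * N%:R)) * (M * rho ^+ n).
    by rewrite exprMn; ring.
  apply: ler_pM; rewrite ?trig_norm_ge0// ?mulr_ge0// ?addr_ge0// ?mulr_ge0//.
  rewrite ler_wpM2l ?mulr_ge0// natrM.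
  apply: (@le_trans _ _ (n.+1%:R * (1 + 2 * N%:R))).
    by rewrite mulrDr mulr1 mulrCA lerD2r ler1n.
  by rewrite ler_wpM2r// addr_ge0// mulr_ge0.
have t2 : `|4 * T| * (2 * rho) <= 2^-1 by rewrite radius_dom; lra.
have t1 : `|4 * T| * rho <= 2^-1.
  by have := radius_dom 1; rewrite mul1r => ->; lra.
have -> : \sum_(k <- F) jap R k * kg_weight k = psum S (4 * T).
  rewrite /S (psum_sum F rho_ge0 t1 (fun k => geoZ (jap R k) (geo_norm
    (geo_fcoef k)))).
  apply: eq_bigr => k _.
  by rewrite (psumZ _ rho_ge0 t1 (geo_norm (geo_fcoef k))).
by apply: le_trans (ler_norm _) _; exact: geo_le gS.
Qed.

Lemma dom_radius : 4 * T * (8 * rho) <= 2^-1.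
Proof. by have := radius_dom 8;
  rewrite ger0_norm ?mulr_ge0 ?(ltW kg_time_gt0)// => ->; lra. Qed.

Lemma kg_weight_ge0 k : 0 <= kg_weight k.
Proof. exact: (dominating_ge0 rho0 kg_time_gt0 dom_radius (geo_fcoef k)). Qed.

Lemma kg_weight_le k : kg_weight k <= kg_bound.
Proof.
have := @kg_weight_sum [:: k] isT; rewrite big_seq1; apply: le_trans.
by rewrite ler_peMl ?kg_weight_ge0// jap_ge1.
Qed.

Lemma in_kg_time t : 0 <= t <= T -> `|t| <= T /\ `|t| < 2 * T.
Proof.
move=> /andP[t0 tT]; rewrite ger0_norm//; split => //.
by apply: le_lt_trans tT _; have := kg_time_gt0; lra.
Qed.

(** Dominates the constants 1, 1 / T and 1 / T^2 of the estimates of the solution,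
    of its time derivative and of their difference quotients. *)
Definition kg_lip : R := 1 + T^-1 + (T ^+ 2)^-1.

Lemma kg_lip_ge : [/\ 0 <= kg_lip, 1 <= kg_lip, T^-1 <= kg_lip &
  (T ^+ 2)^-1 <= kg_lip].
Proof.
have h1 : 0 <= T^-1 by rewrite invr_ge0 ltW// kg_time_gt0.
have h2 : 0 <= (T ^+ 2)^-1 by rewrite invr_ge0 sqr_ge0.
by rewrite /kg_lip; split; lra.
Qed.

Lemma kg_sol_dom t k : 0 <= t <= T ->
  `|fourier (u t) k| <= kg_lip * kg_weight k.
Proof.
move=> /in_kg_time[tT t2]; rewrite fourier_kg_sol//.
apply: le_trans (psum_dom rho0 kg_time_gt0 dom_radius (geo_fcoef k) tT) _.
by have [_ h _ _] := kg_lip_ge; rewrite ler_peMl ?kg_weight_ge0.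
Qed.

Lemma kg_dsol_dom t k : 0 <= t <= T -> `|ut t k| <= kg_lip * kg_weight k.
Proof.
move=> /in_kg_time[tT t2].
apply: le_trans (psum_diffs_dom rho0 kg_time_gt0 dom_radius (geo_fcoef k) tT) _.
by have [_ _ h _] := kg_lip_ge; rewrite ler_wpM2r ?kg_weight_ge0.
Qed.

Lemma kg_sol_lip s t k : 0 <= s <= T -> 0 <= t <= T ->
  `|fourier (u s) k - fourier (u t) k| <= `|s - t| * kg_lip * kg_weight k.
Proof.
move=> /in_kg_time[sT s2] /in_kg_time[tT t2]; rewrite !fourier_kg_sol//.
apply: le_trans (psum_lip rho0 kg_time_gt0 dom_radius (geo_fcoef k) sT tT) _.
have [_ _ h _] := kg_lip_ge.
by rewrite ler_wpM2r ?kg_weight_ge0// ler_wpM2l.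
Qed.

Lemma kg_dsol_lip s t k : 0 <= s <= T -> 0 <= t <= T ->
  `|ut s k - ut t k| <= `|s - t| * kg_lip * kg_weight k.
Proof.
move=> /in_kg_time[sT s2] /in_kg_time[tT t2].
apply: le_trans (psum_diffs_lip rho0 kg_time_gt0 dom_radius (geo_fcoef k) sT
  tT) _.
have [_ _ _ h] := kg_lip_ge.
by rewrite ler_wpM2r ?kg_weight_ge0// ler_wpM2l.
Qed.

Lemma kg_sol0 k : fourier (u 0) k = fourier (trig_eval p0) k.
Proof.
by rewrite fourier_kg_sol ?psum0// normr0; have := kg_time_gt0; lra.
Qed.

Lemma kg_dsol0 k : ut 0 k = fourier (trig_eval p1) k.
Proof. by rewrite /kg_dsol psum0 /pseries_diffs mul1r. Qed.

Lemma bounded_meas_kg_sol t : `|t| < 2 * T -> bounded_meas (2 * M) (u t).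
Proof.
by move=> tT; exact: bounded_meas_psum rho_ge0 (radius_one tT)
  bounded_meas_coef.
Qed.

Lemma kg_strong_solution t : 0 <= t <= T ->
  strong_solution t (fourier (trig_eval p0), fourier (trig_eval p1)) u ut.
Proof.
move=> /andP[t0 tT].
have sub s : 0 <= s <= t -> 0 <= s <= T.
  by move=> /andP[-> st]; rewrite (le_trans st).
have mu : measurable_fun ((`[0, t]%classic : set R1) `*` @torus R)
    (fun p : R1 * R3 => u p.1 p.2).
  apply: (@measurable_fun_cvg _ _ _ _
    (fun m (p : R1 * R3) => pseries (fun n => trig_eval (U n) p.2) p.1 m)).
    move=> m; apply: (@measurable_funS _ _ _ _ setT) => //.
    rewrite /pseries /series/=; apply: measurable_sum => n.
    apply: measurable_funM; last by apply: measurable_funX;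
      exact: measurable_fst.
    exact: measurableT_comp (bounded_meas_coef n).1 measurable_snd.
  move=> [s x] [/= s0t _]; apply: (geo_cvg rho_ge0 _ (geo_coef x));
    apply: radius_one.
  by have [] : `|s| <= T /\ `|s| < 2 * T by apply/in_kg_time/sub; move: s0t;
    rewrite in_itv.
split.
- move=> s /sub sT; have [_ s2] := in_kg_time sT.
  have bu := bounded_meas_kg_sol s2; split; first exact: measurable_funS bu.1.
  have iu := bounded_meas_integrable (bounded_measM bu bu).
  have /integrableP[_] := iu; apply: le_lt_trans.
  rewrite le_eqVlt; apply/orP; left; apply/eqP; apply: eq_integral => x _ /=.
  by rewrite -expr2 ger0_norm// sqr_ge0.
- move=> s /sub sT; apply: le_lt_trans (ltry (2 * (kg_lip * kg_bound))).
  apply: (phase_norm_le kg_bound_ge0 _ kg_weight_ge0).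
  + by have [] := kg_lip_ge.
  + by move=> k; exact: kg_sol_dom.
  + by move=> k; exact: kg_dsol_dom.
  + exact: kg_weight_sum.
- move=> s st.
  have cv : ((2 * (`|x - s| * kg_lip * kg_bound))%:E @[x --> within `[0,
    t] (nbhs s)]
      --> 0%E).
    apply: cvg_within_filter; apply: cvg_EFin; first by near=> x.
    rewrite (_ : _ \o _ = fun x => 2 * (`|x - s| * kg_lip * kg_bound))//.
    have -> : (0 : R) = 2 * (`|s - s| * kg_lip * kg_bound) by rewrite subrr
      normr0 !mul0r mulr0.
    apply: cvgMr; apply: cvgMl; apply: cvgMl; apply: cvg_norm.
    by apply: cvgB; [exact: cvg_id|exact: cvg_cst].
  apply: (@squeeze_cvge _ _ _ _ (cst 0%E) _ _ _ _ (cvg_cst _) cv).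
  near=> x; apply/andP; split; first exact: poweR_ge0.
  have xt : 0 <= x <= t.
    suff : (`[0, t]%classic : set R) x by rewrite /= in_itv.
    by near: x; apply: withinT.
  apply: (phase_norm_le kg_bound_ge0 _ kg_weight_ge0).
  + by have [h _ _ _] := kg_lip_ge; rewrite mulr_ge0.
  + by move=> k; apply: kg_sol_lip; exact: sub.
  + by move=> k; apply: kg_dsol_lip; exact: sub.
  + exact: kg_weight_sum.
- exact: mu.
- have : (leb1 R \x @leb3 R)%E.-integrable (`[0, t]%classic `*` @torus R)
      (EFin \o (fun p : R1 * R3 => u p.1 p.2 ^+ 4)).
    apply: measurable_bounded_integrable.
    + by apply: measurableX => //; exact: measurable_torus.
    + rewrite [X in (X < _)%E](product_measure1E (leb1 R) (@leb3 R))//=;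
      last exact: measurable_torus.
      rewrite lebesgue_measure_itv/= [X in (_ * X)%E]leb3_torus.
      by case: ifP => _; rewrite ?mul0e -?EFinD -?EFinM ltry.
    + exact: measurable_funX.
    + exists ((2 * M) ^+ 4); split; first exact: num_real.
      move=> y My [s x] [/= s0t _]; apply: le_trans (ltW My).
      rewrite normrX lerXn2r ?nnegrE// ?mulr_ge0//.
      have [_ s2] : `|s| <= T /\ `|s| < 2 * T.
        by apply/in_kg_time/sub; move: s0t; rewrite in_itv.
      exact: (bounded_meas_kg_sol s2).2.
  move=> /integrableP[_]; apply: le_lt_trans.
  rewrite le_eqVlt; apply/orP; left; apply/eqP; apply: eq_integral => p _ /=.
  by rewrite ger0_norm// -[4%N]/(2 * 2)%N exprM sqr_ge0.
- by congr pair; apply/funext => k; [exact: kg_sol0|exact: kg_dsol0].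
- move=> s k /andP[s0 st].
  have [sT s2] : `|s| <= T /\ `|s| < 2 * T by apply: in_kg_time; apply: sub;
    rewrite !ltW.
  have := is_derive_fcoef k s2; apply: near_eq_is_derive.
  near=> x; rewrite fourier_kg_sol//.
  near: x; apply: (@cvgr_lt _ _ _ _ (fun x : R => `|x|) `|s|) s2.
  by apply: cvg_norm; exact: cvg_id.
- move=> s k /andP[s0 st].
  have small2 x : 0 <= x <= s -> `|x| < 2 * T.
    by move=> /andP[x0 xs]; have [] := in_kg_time (sub x _);
      rewrite // x0 (le_trans xs).
  rewrite fourier_kg_sol; last by apply: small2; rewrite s0 lexx.
  have jn0 : jap R k != 0 by rewrite gt_eqF// jap_gt0.
  have -> := @oscillator_duhamel _ (psum (c k)) (ut ^~ k) (psum (d k)) (jap R k)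
    s jn0 s0 (fun x xs => is_derive_fcoef k (small2 x xs))
    (fun x xs => is_derive_kg_dsol k (small2 x xs)) (fun x xs =>
      continuous_cubecoef (small2 x xs)).
  have -> : psum (c k) 0 = fourier (trig_eval p0) k by rewrite psum0.
  rewrite kg_dsol0 /=; congr (_ + _ + - _); apply: eq_Rintegral => x.
  by rewrite inE/= in_itv/= => /small2 x2; rewrite fourier_kg_cube.
Unshelve. all: by end_near. Qed.

End LocalSolution.

Section Data.
Variable R : realType.

Definition int_range (N : nat) : seq int :=
  [seq (i%:Z - N%:Z) | i <- iota 0 (N + N).+1].

Definition box (N : nat) : seq Z3 :=
  [seq (ab, c) | ab <- [seq (a, b) | a <- int_range N, b <- int_range N],
                 c <- int_range N].

Lemma mem_int_range N (z : int) : (z \in int_range N) = (absz z <= N)%N.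
Proof.
apply/mapP/idP => [[i]|zN]; first by rewrite mem_iota => /andP[_ iN] ->; lia.
by exists (absz (z + N%:Z)); [rewrite mem_iota; lia|lia].
Qed.

Lemma mem_box N k : (k \in box N) = in_box N k.
Proof.
case: k => [[a b] c]; rewrite /in_box /= -!mem_int_range.
rewrite /box; apply/idP/and3P => [/allpairsP[[ab c'] [hab hc [abE ->]]]|[ha hb
  hc]].
  by case/allpairsP: hab => -[a' b'] [ha hb];
    rewrite -[ab]/((ab, c').1) -abE => -[-> ->].
apply/allpairsP; exists ((a, b), c); split => //.
by apply/allpairsP; exists (a, b).
Qed.

Lemma uniq_box N : uniq (box N).
Proof.
have u : uniq (int_range N).
  by rewrite map_inj_uniq ?iota_uniq// => i j; lia.
by apply: allpairs_uniq => //;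
  [apply: allpairs_uniq => // -[? ?] [? ?] _ _ [-> ->]|move=> -[? ?] [? ?] _ _
  [-> ->]].
Qed.

Lemma freq_norm_box N k : freq_norm R k <= N%:R -> in_box N k.
Proof.
move=> kN.
have sqN : k.1.1%:~R ^+ 2 + k.1.2%:~R ^+ 2 + k.2%:~R ^+ 2 <= N%:R ^+ 2 :> R.
  rewrite -[leLHS]sqr_sqrtr ?addr_ge0 ?sqr_ge0//.
  by rewrite ler_pXn2r ?nnegrE ?sqrtr_ge0.
have h (z : int) : (z%:~R ^+ 2 : R) <= N%:R ^+ 2 -> (absz z <= N)%N.
  rewrite -real_normK ?num_real// ler_pXn2r ?nnegrE// -intr_norm -abszE.
  by rewrite -[(_%:Z)%:~R]/(_%:R) ler_nat.
have s1 := sqr_ge0 (k.1.1%:~R : R); have s2 := sqr_ge0 (k.1.2%:~R : R).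
have s3 := sqr_ge0 (k.2%:~R : R).
by apply/and3P; split; apply: h; lra.
Qed.

Definition trig_of_distr (N : nat) (a : distr R) : trigpoly R :=
  [seq (a k * basis_amp R k, basis_phase R k, k) | k <- box N].

Lemma trig_supp_of_distr N a : trig_supp N (trig_of_distr N a).
Proof. by rewrite /trig_supp all_map; apply/allP => k /=; rewrite mem_box. Qed.

Lemma trig_norm_of_distr N a C : (forall k, in_box N k -> `|a k| <= C) ->
  trig_norm (trig_of_distr N a) <= (size (box N))%:R * (C * basis_bound R).
Proof.
move=> aC; rewrite /trig_norm big_map /= mulr_natl.
have -> : C * basis_bound R *+ size (box N)
  = \sum_(k <- box N) C * basis_bound R.
  by rewrite big_const_seq count_predT iter_addr_0.
rewrite big_seq [leRHS]big_seq; apply: ler_sum => k; rewrite mem_box => kN.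
by rewrite normrM ler_pM// ?aC// basis_amp_le.
Qed.

Lemma fourier_of_distr N a l : (forall k, ~~ in_box N k -> a k = 0) ->
  fourier (trig_eval (trig_of_distr N a)) l = a l.
Proof.
move=> aN; rewrite fourier_trig big_map /=.
transitivity (\sum_(k <- box N) a k * (k == l)%:R).
  apply: eq_bigr => k _; rewrite -mulrA -(fourierZ _ _ (bounded_meas_wave _ _)).
  rewrite -fourier_basis; congr (_ * fourier _ _); apply/funext => x.
  by rewrite trig_basisE.
rewrite sum_delta ?uniq_box// mem_box; case: ifPn => // lN; by rewrite aN.
Qed.

(** Data with frequencies in the box and coefficients at most C have amplitudes
    whose sum is bounded in terms of N and C, which makes the time of existence
    and the speed of the coefficients uniform. *)
Lemma local_existence (N : nat) (C : R) : 0 <= C ->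
  exists T L : R, [/\ 0 < T, 0 < L & forall d : phase R,
    (forall k, ~~ in_box N k -> d.1 k = 0 /\ d.2 k = 0) ->
    (forall k, in_box N k -> `|d.1 k| <= C /\ `|d.2 k| <= C) ->
    exists u ut, forall t, 0 <= t <= T ->
      strong_solution t d u ut /\
      forall k, `|fourier (u t) k - d.1 k| <= L * t].
Proof.
move=> C0; pose M := (size (box N))%:R * (C * basis_bound R).
have M0 : 0 <= M by rewrite !mulr_ge0// basis_bound_ge0.
pose rho : R := 1 + 2 * N%:R + M.
have N0 : 0 <= (N%:R : R) by [].
have rho1 : 1 <= rho by rewrite /rho; lra.
have rho0 : 0 < rho by lra.
have rhoM : 1 + 3 * N%:R ^+ 2 + M ^+ 2 <= rho ^+ 2.
  by rewrite /rho; nra.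
have [L0 L1 _ _] := kg_lip_ge rho0; have K0 := kg_bound_ge0 N M0.
exists (kg_time rho), (1 + kg_lip rho * kg_bound N M); split.
- exact: kg_time_gt0.
- by rewrite ltr_pwDl// mulr_ge0.
move=> d dN dC; pose p0 := trig_of_distr N d.1; pose p1 := trig_of_distr N d.2.
have p0N : trig_supp N p0 by exact: trig_supp_of_distr.
have p1N : trig_supp N p1 by exact: trig_supp_of_distr.
have p0M : trig_norm p0 <= M by apply: trig_norm_of_distr => k /dC[].
have p1M : trig_norm p1 <= M * rho.
  apply: (@le_trans _ _ M); last by rewrite ler_peMr.
  by apply: trig_norm_of_distr => k /dC[].
have f0 k : fourier (trig_eval p0) k = d.1 k.
  by apply: fourier_of_distr => l /dN[].
have f1 k : fourier (trig_eval p1) k = d.2 k.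
  by apply: fourier_of_distr => l /dN[].
exists (kg_sol p0 p1), (kg_dsol p0 p1) => t tT; split.
  have -> : d = (fourier (trig_eval p0), fourier (trig_eval p1)).
    rewrite [LHS]surjective_pairing; congr pair; apply/funext => k.
      by rewrite f0.
    by rewrite f1.
  exact: (kg_strong_solution rho0 M0 rhoM).
move=> k; rewrite -f0 -(kg_sol0 rho0 M0 rhoM p0N p1N p0M p1M).
have t0 : 0 <= t by case/andP: tT.
apply: le_trans (kg_sol_lip rho0 M0 rhoM p0N p1N p0M p1M k tT _) _.
  by rewrite lexx ltW// kg_time_gt0.
rewrite subr0 ger0_norm// -mulrA mulrC ler_wpM2r//.
apply: (@le_trans _ _ (kg_lip rho * kg_bound N M)); last by rewrite lerDr.
by rewrite ler_wpM2l// (kg_weight_le rho0 M0 rhoM).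
Qed.

End Data.

(** * Non-squeezing *)

Section Ball.
Variable R : realType.

Lemma phase_space_bound (v : phase R) : phase_space 2^-1 v ->
  exists2 C : R, 0 <= C & (phase_norm 2^-1 v <= C%:E)%E.
Proof.
rewrite /phase_space/= => h;
  have h0 : (0 <= phase_norm 2^-1 v)%E by exact: poweR_ge0.
exists (fine (phase_norm 2^-1 v)); first exact: fine_ge0.
by rewrite fineK// ge0_fin_numE.
Qed.

Definition shift_coef (k0 : Z3) (e : R) (v : phase R) : phase R :=
  (fun k => v.1 k + e * (k == k0)%:R, v.2).

Lemma sobolev_sq_delta (k0 : Z3) (e : R) :
  (sobolev_sq 2^-1 (fun k => (e * (k == k0)%:R)%R) <= (jap R k0 * e ^+ 2)%:E)%E.
Proof.
have j0 k := ltW (jap_gt0 R k).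
apply: esum_le_seq => F uF.
apply: le_trans (sum_delta_le (g := fun k => jap R k * e ^+ 2) (l := k0) uF _).
  apply: ler_sum => k _; rewrite mulfV// powRr1// exprMn mulrA.
  by rewrite le_eqVlt; apply/orP; left; apply/eqP; case: eqP => _;
    rewrite ?expr1n ?expr0n.
by rewrite mulr_ge0 ?sqr_ge0.
Qed.

Lemma shift_in_ball (k0 : Z3) (e rad : R) (v : phase R) : 0 <= rad ->
  jap R k0 * e ^+ 2 <= rad ^+ 2 -> phase_space 2^-1 v ->
  ball_half rad v (shift_coef k0 e v).
Proof.
move=> rad0 he /phase_space_bound[C C0 vC]; split.
  apply: le_lt_trans (ltry (2 * C + 2 * rad)).
  apply/phase_norm_leP; first by rewrite addr_ge0// mulr_ge0.
  have /(phase_norm_leP _ C0) tot := vC.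
  have h1 : (sobolev_sq 2^-1 v.1 <= (C ^+ 2)%:E)%E.
    by apply: le_trans tot; rewrite leeDl// sobolev_sq_ge0.
  have h2 : (sobolev_sq (2^-1 - 1) v.2 <= (C ^+ 2)%:E)%E.
    by apply: le_trans tot; rewrite leeDr// sobolev_sq_ge0.
  have h3 := sobolev_sqD_le h1 (sobolev_sq_delta k0 e).
  apply: (le_trans (leeD h3 h2)); rewrite -EFinD lee_fin.
  have := mulr_ge0 C0 rad0; have := sqr_ge0 C; move: he; set x := _ * _; nra.
apply/phase_norm_leP => //.
have e1 : (sobolev_sq 2^-1 (shift_coef k0 e v - v)%R.1
  <= (jap R k0 * e ^+ 2)%:E)%E.
  rewrite (_ : (_ - _).1 = fun k => e * (k == k0)%:R);
    first exact: sobolev_sq_delta.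
  by apply/funext => k;
    rewrite /= -[LHS]/(v.1 k + e * (k == k0)%:R - v.1 k) addrC addKr.
have e2 : (sobolev_sq (2^-1 - 1) (shift_coef k0 e v - v)%R.2 <= 0%:E)%E.
  apply: esum_le_seq => F uF; rewrite big1// => k _.
  by rewrite -[X in _ * X ^+ 2]/(v.2 k - v.2 k) subrr expr0n mulr0.
by apply: (le_trans (leeD e1 e2)); rewrite adde0 lee_fin.
Qed.

Lemma ball_coef (rad C : R) (v u : phase R) (k : Z3) : 0 <= rad -> 0 <= C ->
  (phase_norm 2^-1 v <= C%:E)%E -> ball_half rad v u ->
  `|u.1 k| <= jap R k * (rad + C) /\ `|u.2 k| <= jap R k * (rad + C).
Proof.
move=> rad0 C0 vC [_ uv].
have [d1 d2] := phase_norm_coef k rad0 uv;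
  have [v1 v2] := phase_norm_coef k C0 vC.
rewrite mulrDr; split.
  by rewrite -(subrK (v.1 k) (u.1 k)) (le_trans (ler_normD _ _))// lerD.
by rewrite -(subrK (v.2 k) (u.2 k)) (le_trans (ler_normD _ _))// lerD.
Qed.

Lemma cylinder_coef (r : R) (z : R * R) (k0 : Z3) (v : phase R) : 0 <= r ->
  cylinder r z k0 v -> Num.sqrt (jap R k0) * `|v.1 k0 - z.1| <= r.
Proof.
have j0 := jap_gt0 R k0.
move=> r0 [_ h]; rewrite -(@ler_pXn2r _ 2) ?nnegrE ?mulr_ge0 ?sqrtr_ge0//.
rewrite exprMn sqr_sqrtr ?(ltW j0)// real_normK ?num_real//.
by apply: le_trans h; rewrite lerDl mulr_ge0 ?sqr_ge0// invr_ge0 ltW.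
Qed.

End Ball.

Unset Implicit Arguments.
Set Strict Implicit.
Set Printing Implicit Defensive.

Theorem theorem1p1 (R : realType) (ustar : phase R)
    (hustar : phase_space 2^-1 ustar) :
  exists (N : R -> R -> Z3 -> nat) (sigma : R -> nat -> R),
  forall (rad : R) (k0 : Z3) (z : R * R) (eta : R),
    0 < rad -> 0 < eta < rad ->
    0 < sigma eta (N eta rad k0) /\
    forall t : R, 0 <= t <= sigma eta (N eta rad k0) ->
      let A := freq_proj (N eta rad k0) @` ball_half rad ustar in
      flow_defined_on t A /\
      forall r : R, 0 < r -> r < rad - eta ->
        ~ (flow_image t A `<=` cylinder r z k0).
Proof.
have [C C0 ustarC] := phase_space_bound hustar.
have C'0 (N : nat) : 0 <= (1 + 2 * N%:R) * (N%:R + C).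
  by rewrite mulr_ge0// ?addr_ge0// mulr_ge0.
have /choice[TL hTL] : forall N : nat, exists TL : R * R, [/\ 0 < TL.1,
  0 < TL.2 &
    forall d : phase R,
    (forall k, ~~ in_box N k -> d.1 k = 0 /\ d.2 k = 0) ->
    (forall k, in_box N k -> `|d.1 k| <= (1 + 2 * N%:R) * (N%:R + C)
       /\ `|d.2 k| <= (1 + 2 * N%:R) * (N%:R + C)) ->
    exists u ut, forall t, 0 <= t <= TL.1 ->
      strong_solution t d u ut /\
      forall k, `|fourier (u t) k - d.1 k| <= TL.2 * t].
  by move=> N; have [T [L h]] := local_existence N (C'0 N); exists (T, L).
(* As N exceeds rad, a time that depends on N only can be used for the whole ball;
   as N exceeds |k0|, the projection keeps the coefficient at k0. *)
exists (fun _ rad k0 => Num.bound (rad + freq_norm R k0)).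
(* The second bound makes the coefficient at k0 move by at most eta / <k0>^(1/2),
   because 1 + 2 N >= <k0> >= <k0>^(1/2). *)
exists (fun eta N => Num.min (TL N).1 (eta / ((TL N).2 * (1 + 2 * N%:R)))).
move=> rad k0 z eta rad0 /andP[eta0 etarad].
set N := Num.bound _; have [T0 L0 sol] := hTL N.
move: (TL N) T0 L0 sol => [T L] /= T0 L0 sol.
have f0 : 0 <= freq_norm R k0 by exact: sqrtr_ge0.
have NE : rad + freq_norm R k0 < N%:R by apply: archi_boundP;
  rewrite addr_ge0// ltW.
have radN : rad <= N%:R by lra.
have k0N : freq_norm R k0 <= N%:R by lra.
have N0 : 0 <= (N%:R : R) by [].
have N1 : 0 < 1 + 2 * N%:R :> R by lra.
have LN0 : 0 < L * (1 + 2 * N%:R) by rewrite mulr_gt0.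
split; first by rewrite lt_min T0 divr_gt0.
move=> t; rewrite le_min => /and3P[t0 tT tL].
have solA v : ball_half rad ustar v -> exists u ut,
    strong_solution t (freq_proj N v) u ut /\
    `|fourier (u t) k0 - (freq_proj N v).1 k0| <= L * t.
  move=> bv; have [||u [ut h]] := sol (freq_proj N v).
  - move=> k kN; rewrite /freq_proj /proj_distr /=;
    case: ifPn => [/freq_norm_box|//].
    by rewrite (negbTE kN).
  - move=> k kN; have [b1 b2] := ball_coef k (ltW rad0) C0 ustarC bv.
    have jC : jap R k * (rad + C) <= (1 + 2 * N%:R) * (N%:R + C).
      apply: ler_pM; rewrite ?lerD2r ?jap_box// ?(ltW (jap_gt0 R k))//.
      by rewrite addr_ge0// ltW.
    by rewrite /freq_proj /proj_distr /=; case: ifP => _; rewrite ?normr0;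
      split => //;
      apply: le_trans jC.
  exists u, ut; have [|hs hk] := h t; first by rewrite t0.
  by split => //; exact: hk.
split.
  move=> _ [v bv <-]; have [u [ut [hs _]]] := solA v bv.
  by exists (fourier (u t), ut t), u, ut.
move=> r r0 rlt sub.
set q := Num.sqrt (jap R k0).
have q0 : 0 < q by rewrite sqrtr_gt0 jap_gt0.
(* The two data are those for e = rad and e = - rad. *)
have coef e : e ^+ 2 = rad ^+ 2 ->
    exists2 a : R, q * `|a - z.1| <= r & `|a - (ustar.1 k0 + e / q)| <= L * t.
  move=> erad.
  have bv : ball_half rad ustar (shift_coef k0 (e / q) ustar).
    apply: shift_in_ball => //; first exact: ltW.
    rewrite expr_div_n erad sqr_sqrtr ?(ltW (jap_gt0 R k0))//.
    by rewrite mulrC divfK// gt_eqF// jap_gt0.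
  have [u [ut [hs hk]]] := solA _ bv.
  exists (fourier (u t) k0).
    apply: (@cylinder_coef _ _ _ _ (fourier (u t), ut t) (ltW r0)); apply: sub.
    exists (freq_proj N (shift_coef k0 (e / q) ustar)); last by exists u, ut.
    by exists (shift_coef k0 (e / q) ustar).
  move: hk; rewrite /freq_proj /proj_distr/= k0N.
  by rewrite /shift_coef /= eqxx mulr1.
have [a ar ad] := coef rad erefl.
have [b br bd] := coef (- rad) (sqrrN rad).
have q1 : q <= 1 + 2 * N%:R.
  have j1 := jap_ge1 R k0; apply: le_trans (jap_box R (freq_norm_box k0N)).
  rewrite -(@ler_pXn2r _ 2) ?nnegrE ?sqrtr_ge0// sqr_sqrtr ?(ltW (jap_gt0 R
    k0))//.
  by rewrite expr2 ler_peMl// ltW// jap_gt0.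
have qLt : q * (L * t) <= eta.
  apply: (@le_trans _ _ ((1 + 2 * N%:R) * (L * t))).
    by rewrite ler_wpM2r// mulr_ge0// ltW.
  have -> : (1 + 2 * N%:R) * (L * t) = t * (L * (1 + 2 * N%:R)) by ring.
  by rewrite -ler_pdivlMr.
have qrad : q * (rad / q) = rad by rewrite mulrC divfK// gt_eqF.
have ab : 2 * rad <= q * `|a - z.1| + q * `|b - z.1| + 2 * (q * (L * t)).
  have h : 2 * (rad / q) <= `|a - z.1| + `|b - z.1| + 2 * (L * t).
    move: ad bd; rewrite mulNr !ler_norml => /andP[a1 a2] /andP[b1 b2].
    have := ler_norm (a - z.1); have := ler_norm (- (b - z.1)); rewrite normrN.
    by lra.
  have := ler_wpM2l (ltW q0) h; lra.
by lra.
Qed.
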